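(* Let $q\in(0,2]$, $a_k=\exp(\alpha k)$ and $\sigma_k=\exp(\beta k)$, $k\in\mathbb N$, with $\alpha>0$, $\beta>0$. All limits are as $\varepsilon\to0$. (a) Let $u_\varepsilon=u_\varepsilon(r_\varepsilon)$ be given by $u_\varepsilon^2=\frac{1}{2\varepsilon^4}\inf_{\eta\in\Theta_2(r_\varepsilon)}\sum_k\eta_k^4$, let $\{\tilde\eta_k\}$ be the extreme sequence of this problem, $w_k=\tilde\eta_k^2/\sqrt{2\sum_j\tilde\eta_j^4}$, $t_\varepsilon=\sum_kw_k\big((y_k/\varepsilon)^2-1\big)$ and $\psi_{\varepsilon,H}=\mathbf 1_{\{t_\varepsilon>H\}}$. If $u_\varepsilon\to\infty$, then for any $c\in(0,1)$ the family $\psi_{\varepsilon,H}$ with $H=H_\varepsilon\sim c\,u_\varepsilon$ is asymptotically minimax consistent, that is, $\gamma_\varepsilon(\Theta_q(r_\varepsilon),\psi_{\varepsilon,H_\varepsilon})\to0$. (b) The separation rates (for the alternatives $\Theta_q(r_\varepsilon)$) are of the form $$r_\varepsilon^*=\varepsilon^{\alpha/(\alpha+\beta)}.$$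
   Context: Model: one observes $y=\{y_k\}_{k\in\mathbb N}$, $y_k=\eta_k+\varepsilon\xi_k$, with $\xi_k$ i.i.d. $N(0,1)$, $\varepsilon>0$ small, $\eta\in\ell^2$ unknown; $E_{\varepsilon,\eta}$ is the corresponding expectation. Sets: for $q\in(0,2]$, $\Theta_q=\{\eta\in\ell^2:\sum_k|a_k\sigma_k\eta_k|^q\le1\}$, $\Theta_q(r)=\{\eta\in\Theta_q:\sum_k\sigma_k^2\eta_k^2\ge r^2\}$. $r_\varepsilon>0$ is a family with $r_\varepsilon\to0$ as $\varepsilon\to0$. One tests $H_0:\eta=0$ against $H_1:\eta\in\Theta_q(r_\varepsilon)$. Tests and errors: a (randomized) test $\psi$ is a measurable function of $y$ with values in $[0,1]$. $\alpha_\varepsilon(\psi)=E_{\varepsilon,0}\psi$, $\beta_\varepsilon(\Theta,\psi)=\sup_{\eta\in\Theta}E_{\varepsilon,\eta}(1-\psi)$, $\gamma_\varepsilon(\Theta,\psi)=\alpha_\varepsilon(\psi)+\beta_\varepsilon(\Theta,\psi)$. $\beta_\varepsilon(r,\vartheta)=\inf_{\psi:\alpha_\varepsilon(\psi)\le\vartheta}\beta_\varepsilon(\Theta_q(r),\psi)$ for a level $\vartheta\in(0,1)$, and $\gamma_\varepsilon(r)=\inf_\psi\gamma_\varepsilon(\Theta_q(r),\psi)$. Separation rate: a positive family $r_\varepsilon^*\to0$ such that $\gamma_\varepsilon(r_\varepsilon)\to1$ and $\beta_\varepsilon(r_\varepsilon,\vartheta)\to1-\vartheta$ for any $\vartheta\in(0,1)$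 as $r_\varepsilon/r_\varepsilon^*\to0$, while $\gamma_\varepsilon(r_\varepsilon)\to0$ and $\beta_\varepsilon(r_\varepsilon,\vartheta)\to0$ for any $\vartheta\in(0,1)$ as $r_\varepsilon/r_\varepsilon^*\to\infty$. The (nonnegative) extreme sequence, for $r_\varepsilon$ small, is $\tilde\eta_k^2=z_0^2\sigma_k^2(1-Aa_k^2)_+$, where $(x)_+=\max\{0,x\}$ and $z_0=z_{0,\varepsilon}$, $A=A_\varepsilon$ are determined by $\sum_k\sigma_k^2\tilde\eta_k^2=r_\varepsilon^2$ and $\sum_ka_k^2\sigma_k^2\tilde\eta_k^2=1$. $A_\varepsilon\sim B_\varepsilon$ means the ratio tends to $1$. *)

(* Defs.v *)
From HB Require Import structures.
From mathcomp Require Import all_boot all_order all_algebra.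
From mathcomp Require Import finmap.
From mathcomp Require Import all_classical all_reals all_analysis.

Set Implicit Arguments.
Unset Strict Implicit.
Unset Printing Implicit Defensive.

Import Order.TTheory GRing.Theory Num.Theory.
Import numFieldNormedType.Exports.

Local Open Scope classical_set_scope.
Local Open Scope ring_scope.

(* Sequences indexed by {1, 2, ...} are represented by functions on nat:
   the value at i : nat is the coordinate number i.+1. *)
Definition exp_seq (R : realType) (c : R) (i : nat) : R := expR (c * i.+1%:R).

Definition mutually_independent (R : realType) (d : measure_display)
    (Omega : measurableType d) (P : probability Omega R)
    (xi : nat -> {RV P >-> R}) : Prop :=
  forall (J : {fset nat}) (B : nat -> set R),
    (forall k, k \in J -> measurable (B k)) ->
    P (\bigcap_(k in [set` J]) (xi k @^-1` B k)) =
    (\prod_(k <- J) P (xi k @^-1` B k))%E.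

Definition iid_std_normal (R : realType) (d : measure_display)
    (Omega : measurableType d) (P : probability Omega R)
    (xi : nat -> {RV P >-> R}) : Prop :=
  mutually_independent xi /\
  forall k (A : set R), measurable A ->
    distribution P (xi k) A = normal_prob 0 1 A.

Definition observation (R : realType) (d : measure_display)
    (Omega : measurableType d) (P : probability Omega R)
    (xi : nat -> {RV P >-> R}) (eps : R) (eta : nat -> R)
    (omega : Omega) : nat -> R :=
  fun k => eta k + eps * xi k omega.

Definition obs_expectation (R : realType) (d : measure_display)
    (Omega : measurableType d) (P : probability Omega R)
    (xi : nat -> {RV P >-> R}) (eps : R) (eta : nat -> R)
    (psi : (nat -> R) -> R) : \bar R :=
  'E_P[fun omega => psi (observation xi eps eta omega)]%E.

Definition Theta (R : realType) (a sigma : nat -> R) (q : R) :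
    set (nat -> R) :=
  [set eta | (\sum_(k <oo) (eta k ^+ 2)%:E < +oo)%E /\
             (\sum_(k <oo) (`|a k * sigma k * eta k| `^ q)%:E <= 1)%E].

Definition Theta_alt (R : realType) (a sigma : nat -> R) (q r : R) :
    set (nat -> R) :=
  [set eta | Theta a sigma q eta /\
     ((r ^+ 2)%:E <= \sum_(k <oo) (sigma k ^+ 2 * eta k ^+ 2)%:E)%E].

(* The sigma-algebra on R^N is the one generated by the coordinates. *)
Definition coordinate_preimages (R : realType) : set (set (nat -> R)) :=
  \bigcup_(k in [set: nat])
    preimage_set_system [set: nat -> R] (fun y => y k) measurable.

Definition is_test (R : realType) (psi : (nat -> R) -> R) : Prop :=
  measurable_fun
    [set: g_sigma_algebraType (@coordinate_preimages R)] psi /\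
  forall y, 0 <= psi y <= 1.

Definition type1_error (R : realType) (d : measure_display)
    (Omega : measurableType d) (P : probability Omega R)
    (xi : nat -> {RV P >-> R}) (eps : R) (psi : (nat -> R) -> R) : \bar R :=
  obs_expectation xi eps (fun=> 0) psi.

Definition type2_error (R : realType) (d : measure_display)
    (Omega : measurableType d) (P : probability Omega R)
    (xi : nat -> {RV P >-> R}) (eps : R) (T : set (nat -> R))
    (psi : (nat -> R) -> R) : \bar R :=
  ereal_sup [set obs_expectation xi eps eta (fun y => 1 - psi y) | eta in T].

Definition total_error (R : realType) (d : measure_display)
    (Omega : measurableType d) (P : probability Omega R)
    (xi : nat -> {RV P >-> R}) (eps : R) (T : set (nat -> R))
    (psi : (nat -> R) -> R) : \bar R :=
  (type1_error xi eps psi + type2_error xi eps T psi)%E.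

Definition minimax_type2_error (R : realType) (d : measure_display)
    (Omega : measurableType d) (P : probability Omega R)
    (xi : nat -> {RV P >-> R}) (eps : R) (T : set (nat -> R))
    (theta : R) : \bar R :=
  ereal_inf [set type2_error xi eps T psi | psi in
    [set psi | is_test psi /\ (type1_error xi eps psi <= theta%:E)%E]].

Definition minimax_total_error (R : realType) (d : measure_display)
    (Omega : measurableType d) (P : probability Omega R)
    (xi : nat -> {RV P >-> R}) (eps : R) (T : set (nat -> R)) : \bar R :=
  ereal_inf [set total_error xi eps T psi | psi in
    [set psi | is_test (R := R) psi]].

Definition separation_rate (R : realType) (d : measure_display)
    (Omega : measurableType d) (P : probability Omega R)
    (xi : nat -> {RV P >-> R}) (T : R -> set (nat -> R))
    (rstar : R -> R) : Prop :=
  [/\ forall eps, 0 < eps -> 0 < rstar eps,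
      rstar eps @[eps --> 0^'+] --> (0 : R) &
      forall r : R -> R,
        (forall eps, 0 < eps -> 0 < r eps) ->
        r eps @[eps --> 0^'+] --> (0 : R) ->
        (r eps / rstar eps @[eps --> 0^'+] --> (0 : R) ->
           minimax_total_error xi eps (T (r eps))
             @[eps --> 0^'+] --> 1%:E /\
           forall theta : R, 0 < theta < 1 ->
             minimax_type2_error xi eps (T (r eps)) theta
               @[eps --> 0^'+] --> (1 - theta)%:E) /\
        (r eps / rstar eps @[eps --> 0^'+] --> +oo ->
           minimax_total_error xi eps (T (r eps))
             @[eps --> 0^'+] --> 0%:E /\
           forall theta : R, 0 < theta < 1 ->
             minimax_type2_error xi eps (T (r eps)) theta
               @[eps --> 0^'+] --> 0%:E)].

(* [fine] is harmless when the set is nonempty, that is, for small r; it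
   yields 0 when the set is empty. *)
Definition u_eps (R : realType) (a sigma : nat -> R) (eps r : R) : R :=
  Num.sqrt ((2 * eps ^+ 4)^-1 *
    fine (ereal_inf [set (\sum_(k <oo) (eta k ^+ 4)%:E)%E |
                     eta in Theta_alt a sigma 2 r])).

Definition extreme_sequence (R : realType) (a sigma : nat -> R) (r : R)
    (eta : nat -> R) : Prop :=
  (forall k, 0 <= eta k) /\
  exists z0 A : R,
    [/\ forall k, eta k ^+ 2 =
          z0 ^+ 2 * sigma k ^+ 2 * Num.max 0 (1 - A * a k ^+ 2),
        (\sum_(k <oo) (sigma k ^+ 2 * eta k ^+ 2)%:E = (r ^+ 2)%:E)%E &
        (\sum_(k <oo) (a k ^+ 2 * sigma k ^+ 2 * eta k ^+ 2)%:E = 1)%E].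

Definition weights (R : realType) (eta : nat -> R) (k : nat) : R :=
  eta k ^+ 2 / Num.sqrt (2 * fine (\sum_(j <oo) (eta j ^+ 4)%:E)%E).

(* An extreme sequence has finitely many nonzero terms, so for it the series
   below is a finite sum for every y. *)
Definition statistic (R : realType) (eta : nat -> R) (eps : R)
    (y : nat -> R) : R :=
  limn (series (fun k => weights eta k * ((y k / eps) ^+ 2 - 1))).

Definition threshold_test (R : realType) (eta : nat -> R) (eps H : R) :
    (nat -> R) -> R :=
  \1_[set y | H < statistic eta eps y].

(* Main.v *)
Require Import Defs.
From HB Require Import structures.
From mathcomp Require Import all_boot all_order all_algebra.
From mathcomp Require Import finmap ring lra.
From mathcomp Require Import all_classical all_reals all_analysis.
From mathcomp Require Import measurable_realfun.

Set Implicit Arguments.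
Unset Strict Implicit.
Unset Printing Implicit Defensive.

Import Order.TTheory GRing.Theory Num.Theory.
Import numFieldNormedType.Exports.
Import HBNNSimple.

Local Open Scope classical_set_scope.
Local Open Scope ring_scope.

(* Consider a test rejecting when sum_k w_k ((y_k/eps)^2 - 1) > H, with
   nonnegative weights of bounded total mass. Completing the square bounds both
   errors, via Markov's inequality, by a constant over h, where h is the
   smallest signal sum_k w_k (eta_k/eps)^2 on the alternative. Because a_k and
   sigma_k grow geometrically, the weights of the extreme sequence have bounded
   total mass, and Lagrangian duality gives h >= u_eps; this proves (a).
   Let rho be the ratio of r to the claimed rate. Weights proportional to
   sigma_k^2 for a_k^2 < 2/r^2, and 0 beyond, give h >= const * rho once
   rho >= 1, which is the upper half of (b). For the lower half, a sequence
   whose single nonzero coordinate is r/sigma_k, where a_k is the largest term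
   below 1/r, lies in the alternative and changes the type II error by only
   O(rho). *)

(** * Integration against a density and the Gaussian second moment *)

(** The hypothesis on [nu] is the case of indicators. Linearity extends it to simple functions, and
    monotone convergence along an increasing simple approximation of [f] does the rest. *)
Lemma ge0_integral_density (d : measure_display) (T : measurableType d)
    (R : realType) (mu nu : {measure set T -> \bar R}) (g : T -> R) (f : T -> \bar R) :
  measurable_fun [set: T] g -> (forall x, 0 <= g x) ->
  (forall A, measurable A -> nu A = \int[mu]_(x in A) (g x)%:E)%E ->
  measurable_fun [set: T] f -> (forall x, 0 <= f x)%E ->
  (\int[nu]_x f x = \int[mu]_x (f x * (g x)%:E))%E.
Proof.
move=> mg g0 nuE mf f0.
have mgE : measurable_fun [set: T] (fun x => (g x)%:E) by exact/measurable_EFinP.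
have gE0 x : (0 <= (g x)%:E)%E by rewrite lee_fin.
have indE (A : set T) : measurable A ->
    (\int[mu]_x ((\1_A x)%:E * (g x)%:E) = nu A)%E.
  move=> mA; rewrite nuE// [RHS]integral_mkcond; apply: eq_integral => x _.
  by rewrite epatch_indic muleC.
pose h := nnsfun_approx measurableT mf.
have hE x : limn (fun n => (h n x)%:E) = f x.
  by apply/cvg_lim => //; apply: cvg_nnsfun_approx.
have mh n : measurable_fun [set: T] (fun x => (h n x)%:E).
  exact/measurable_EFinP/measurable_funP.
have h0 n x : (0 <= (h n x)%:E)%E by rewrite lee_fin.
have ndh x (m n : nat) : (m <= n)%N -> ((h m x)%:E <= (h n x)%:E)%E.
  by move=> mn; rewrite lee_fin; exact/lefP/nd_nnsfun_approx.
transitivity (limn (fun n => \int[nu]_x (h n x)%:E))%E.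
  rewrite -monotone_convergence//; last by move=> x _ m n; exact: ndh.
  by apply: eq_integral => x _; rewrite hE.
transitivity (limn (fun n => \int[mu]_x ((h n x)%:E * (g x)%:E)))%E; last first.
  rewrite -monotone_convergence//.
  - apply: eq_integral => x _ /=; apply: cvg_lim => //.
    by apply: cvgeZr => //; exact: cvg_nnsfun_approx.
  - by move=> n; apply: emeasurable_funM.
  - by move=> n x _; rewrite mule_ge0.
  - by move=> x _ m n mn; rewrite lee_wpmul2r// ndh.
congr (limn _); apply/funext => n.
transitivity (\sum_(r \in range (h n)) (r%:E * nu (h n @^-1` [set r])))%E.
  by rewrite integralT_nnsfun sintegralE.
transitivity (\int[mu]_x (\sum_(r \in range (h n))
    ((r * \1_(h n @^-1` [set r]) x)%:E * (g x)%:E)))%E; last first.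
  apply: eq_integral => x _; rewrite -ge0_mule_fsuml; last first.
    by move=> r; exact: nnfun_muleindic_ge0.
  by rewrite fsumEFin// -fimfunE.
rewrite ge0_integral_fsum//; last 2 first.
- by move=> r; apply: emeasurable_funM => //; exact/measurable_EFinP/measurable_funM.
- by move=> r x _; rewrite mule_ge0 ?nnfun_muleindic_ge0.
apply: eq_fsbigr => r; rewrite inE => -[x _ <-].
under eq_integral do rewrite EFinM -muleA.
rewrite ge0_integralZl ?indE//.
- by apply: emeasurable_funM => //; exact/measurable_EFinP.
- by move=> y _; rewrite mule_ge0// lee_fin.
Qed.

(* (1 + x^2) exp (- x^2 / 2) <= 4 exp (- x^2 / 4). *)
Lemma normal_second_moment (R : realType) :
  exists2 M : R, 0 < M &
    (\int[@lebesgue_measure R]_x ((1 + x ^+ 2)%:E * (normal_pdf 0 1 x)%:E)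
       <= M%:E)%E.
Proof.
have s2 : Num.sqrt 2 != 0 :> R by rewrite sqrtr_eq0 -ltNge.
have p1 := @normal_peak_gt0 R 1 (oner_neq0 _).
have p2 := normal_peak_gt0 s2.
pose c : R := 4 * (normal_peak 1 / normal_peak (Num.sqrt 2)).
have c0 : 0 < c by rewrite mulr_gt0// divr_gt0.
exists c => //.
have m1 (s : R) : measurable_fun [set: R] (normal_pdf 0 s).
  exact: measurable_normal_pdf.
apply: (@le_trans _ _
    (\int[@lebesgue_measure R]_x (c%:E * (normal_pdf 0 (Num.sqrt 2) x)%:E))%E).
  apply: ge0_le_integral => //.
  - by move=> x _; rewrite -EFinM lee_fin mulr_ge0 ?normal_pdf_ge0// addr_ge0 ?sqr_ge0.
  - apply: emeasurable_funM; apply/measurable_EFinP; last exact: m1.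
    by apply: measurable_funD => //; exact: measurable_funX.
  - by apply: emeasurable_funM => //; apply/measurable_EFinP; exact: m1.
  move=> x _; rewrite -!EFinM lee_fin !normal_pdfE//.
  rewrite /normal_fun !subr0 sqr_sqrtr// expr1n.
  pose y : R := x ^+ 2 / 4.
  have xy : x ^+ 2 = 4 * y by rewrite /y; field.
  have -> : - x ^+ 2 / 2 = - y - y by rewrite xy; field.
  have -> : - x ^+ 2 / (2 *+ 2) = - y by rewrite xy; field.
  rewrite xy expRD.
  have y0 : 0 <= y by rewrite divr_ge0 ?sqr_ge0.
  have ye : (1 + y) * expR (- y) <= 1.
    by rewrite expRN ler_pdivrMr ?expR_gt0// mul1r expR_ge1Dx.
  have -> : c * (normal_peak (Num.sqrt 2) * expR (- y)) =
      normal_peak 1 * expR (- y) * 4.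
    by rewrite /c; field; rewrite gt_eqF.
  have -> : (1 + 4 * y) * (normal_peak 1 * (expR (- y) * expR (- y))) =
      normal_peak 1 * expR (- y) * ((1 + 4 * y) * expR (- y)) by ring.
  rewrite ler_wpM2l ?mulr_ge0 ?expR_ge0 ?ltW//.
  by have := expR_gt0 (- y); nra.
rewrite ge0_integralZl//.
- by rewrite integral_normal_pdf mule1.
- by apply/measurable_EFinP; exact: m1.
- by move=> x _; rewrite lee_fin normal_pdf_ge0.
- by rewrite lee_fin ltW.
Qed.

Section iid_normal.
Context (R : realType) (d : measure_display) (Omega : measurableType d)
  (P : probability Omega R) (xi : nat -> {RV P >-> R}).
Hypothesis hxi : iid_std_normal xi.

(** The integral passes first to the law of [xi k], which is [normal_prob 0 1], and from there to
    Lebesgue measure through the density. *)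
Lemma std_normal_integral (k : nat) (f : R -> \bar R) :
  measurable_fun [set: R] f -> (forall x, 0 <= f x)%E ->
  (\int[P]_omega f (xi k omega) =
     \int[lebesgue_measure]_x (f x * (normal_pdf 0 1 x)%:E))%E.
Proof.
move=> mf f0.
(* [lebesgue_measure] and [normal_prob] live on [measurableTypeR R], whose
   display differs from that of the canonical structure of [R]. *)
pose X : Omega -> measurableTypeR R := xi k.
have mX : measurable_fun [set: Omega] X := measurable_funPT (xi k).
rewrite -[LHS](ge0_integral_pushforward mX P measurableT mf)//.
apply: ge0_integral_density => //; first exact: measurable_normal_pdf.
  by move=> x; exact: normal_pdf_ge0.
by move=> A mA; exact: hxi.2.
Qed.

End iid_normal.

(** * Measurability for the coordinate sigma-algebra *)

Lemma measurable_coordinate (R : realType) (k : nat) :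
  measurable_fun [set: g_sigma_algebraType (@coordinate_preimages R)]
    (fun y : nat -> R => y k).
Proof.
move=> _ B mB; apply: sub_sigma_algebra; exists k => //.
by exists B.
Qed.

Lemma measurable_coordinatewise (R : realType) (d : measure_display)
    (T : measurableType d)
    (f : T -> g_sigma_algebraType (@coordinate_preimages R)) :
  (forall k, measurable_fun [set: T] (fun x => f x k : R)) ->
  measurable_fun [set: T] f.
Proof.
move=> mf; apply: (@measurability _ _ _
  (g_sigma_algebraType (@coordinate_preimages R)) _ _
  (@coordinate_preimages R)) => //.
move=> _ [_ [k _ [B mB <-]] <-].
by rewrite setTI; apply: mf.
Qed.

(** * Quadratic tests with finitely many weights *)

Section quadratic_test.
Context (R : realType).

(** The weights are left free so that the same error bounds serve the extreme weights of (a) and the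
    truncated weights of (b). *)
Definition quadratic_statistic (n : nat) (w : nat -> R) (eps : R)
    (y : nat -> R) : R :=
  \sum_(k < n) w k * ((y k / eps) ^+ 2 - 1).

Definition quadratic_test (n : nat) (w : nat -> R) (eps H : R) :
    (nat -> R) -> R :=
  \1_[set y | H < quadratic_statistic n w eps y].

Lemma quadratic_test_is_test n w eps H : is_test (quadratic_test n w eps H).
Proof.
split; last first.
  by move=> y; rewrite /quadratic_test indicE; case: (_ \in _); rewrite /= ?lexx ler01.
apply: measurable_indic.
have mT : measurable_fun [set: g_sigma_algebraType (@coordinate_preimages R)]
    (quadratic_statistic n w eps).
  apply: measurable_sum => k; apply: measurable_funM => //.
  apply: measurable_funB => //; apply: measurable_funX.
  by apply: measurable_funM => //; exact: measurable_coordinate.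
rewrite (_ : [set y | _] = quadratic_statistic n w eps @^-1` `]H, +oo[).
  by rewrite -[X in measurable X]setTI; exact: mT.
by apply/seteqP; split=> y /=; rewrite in_itv/= andbT.
Qed.

End quadratic_test.

(** * Markov bounds for both errors of a quadratic test *)

Section chi_square_test.
Context (R : realType) (d : measure_display) (Omega : measurableType d)
  (P : probability Omega R) (xi : nat -> {RV P >-> R}).

Lemma measurable_observation eps eta :
  measurable_fun [set: Omega]
    (observation xi eps eta : Omega -> g_sigma_algebraType (@coordinate_preimages R)).
Proof.
apply: measurable_coordinatewise => k; apply: measurable_funD => //.
exact: measurable_funM.
Qed.

Lemma measurable_test_observation eps eta psi : is_test psi ->
  measurable_fun [set: Omega] (fun omega => psi (observation xi eps eta omega)).
Proof. by case=> mpsi _; apply: (measurableT_comp mpsi (measurable_observation _ _)). Qed.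

Context (M : R).
Hypothesis hM : forall k, (\int[P]_omega (1 + xi k omega ^+ 2)%:E <= M%:E)%E.

Lemma noise_expectation n (w : nat -> R) : (forall k, 0 <= w k) ->
  (\int[P]_omega (\sum_(k < n) w k * (1 + xi k omega ^+ 2))%:E <=
     ((\sum_(k < n) w k) * M)%:E)%E.
Proof.
move=> w0.
have m1 (k : 'I_n) : measurable_fun [set: Omega] (fun omega => (1 + xi k omega ^+ 2)%:E).
  by apply/measurable_EFinP/measurable_funD => //; exact: measurable_funX.
under eq_integral do rewrite -sumEFin.
rewrite ge0_integral_sum//; last 2 first.
- move=> k; under eq_fun do rewrite EFinM.
  by apply: emeasurable_funM => //; exact: measurable_cst.
- by move=> k omega _; rewrite lee_fin mulr_ge0// addr_ge0 ?sqr_ge0.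
rewrite mulr_suml -sumEFin; apply: lee_sum => k _.
under eq_integral do rewrite EFinM.
rewrite ge0_integralZl//.
- by rewrite EFinM lee_wpmul2l ?lee_fin.
- by move=> omega _; rewrite lee_fin addr_ge0 ?sqr_ge0.
- by rewrite lee_fin.
Qed.

(** Markov's inequality in pointwise form: in the applications [f] is the indicator of an error and
    [t] is the inverse of the amount of noise which that error forces. *)
Lemma expectation_le_noise n (w : nat -> R) (C t : R) (f : Omega -> R) :
  (forall k, 0 <= w k) -> \sum_(k < n) w k <= C -> 0 <= M -> 0 <= t ->
  measurable_fun [set: Omega] f -> (forall omega, 0 <= f omega) ->
  (forall omega, f omega <= t * \sum_(k < n) w k * (1 + xi k omega ^+ 2)) ->
  ('E_P[f] <= (t * (C * M))%:E)%E.
Proof.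
move=> w0 wC M0 t0 mf f0 fS; rewrite unlock.
have mS : measurable_fun [set: Omega]
    (fun omega => \sum_(k < n) w k * (1 + xi k omega ^+ 2)).
  apply: measurable_sum => k; apply: measurable_funM => //.
  by apply: measurable_funD => //; exact: measurable_funX.
apply: (@le_trans _ _ (\int[P]_omega
    (t%:E * (\sum_(k < n) w k * (1 + xi k omega ^+ 2))%:E))%E).
  apply: ge0_le_integral => //.
  - by move=> x _; rewrite lee_fin.
  - exact/measurable_EFinP.
  - by apply: emeasurable_funM => //; exact/measurable_EFinP.
  - by move=> x _; rewrite -EFinM lee_fin.
rewrite ge0_integralZl//.
- rewrite EFinM lee_wpmul2l ?lee_fin//.
  by apply: le_trans (noise_expectation n w0) _; rewrite lee_fin ler_wpM2r.
- exact/measurable_EFinP.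
- move=> x _; rewrite lee_fin sumr_ge0// => k _.
  by rewrite mulr_ge0// addr_ge0 ?sqr_ge0.
Qed.

(** Without signal each term is w_k (xi_k^2 - 1) <= w_k (1 + xi_k^2), so a rejection forces the
    noise sum above H. *)
Lemma quadratic_test_type1 n (w : nat -> R) (C eps H : R) :
  (forall k, 0 <= w k) -> \sum_(k < n) w k <= C -> 0 <= M ->
  0 < eps -> 0 < H ->
  (type1_error xi eps (quadratic_test n w eps H) <= (C * M / H)%:E)%E.
Proof.
move=> w0 wC M0 eps0 H0; rewrite /type1_error /obs_expectation mulrC.
apply: (expectation_le_noise w0 wC M0) => [||omega|omega].
- by rewrite invr_ge0 ltW.
- exact/measurable_test_observation/quadratic_test_is_test.
- by have [_ /(_ (observation xi eps (fun=> 0) omega))/andP[]] :=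
    quadratic_test_is_test n w eps H.
have S0 : 0 <= \sum_(k < n) w k * (1 + xi k omega ^+ 2).
  by rewrite sumr_ge0// => k _; rewrite mulr_ge0// addr_ge0 ?sqr_ge0.
rewrite /quadratic_test indicE; case: (boolP (_ \in _)) => [|_]; last first.
  by rewrite mulr_ge0// invr_ge0 ltW.
rewrite inE /= => HT; rewrite ler_pdivlMl// mulr1 (le_trans (ltW HT))//.
apply: ler_sum => k _; rewrite ler_wpM2l//.
have -> : observation xi eps (fun=> 0) omega k / eps = xi k omega.
  by rewrite /observation; field; rewrite gt_eqF.
by lra.
Qed.

(* (theta + x)^2 >= (1 - s) theta^2 + (1 - 1/s) x^2, so a missed detection
   forces the noise term to exceed a fraction of the signal. *)
Lemma quadratic_test_type2 n (w eta : nat -> R) (C eps H s h : R) :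
  (forall k, 0 <= w k) -> \sum_(k < n) w k <= C -> 0 <= M ->
  0 < eps -> 0 < s < 1 -> H < (1 - s) * h ->
  h <= \sum_(k < n) w k * (eta k / eps) ^+ 2 ->
  (obs_expectation xi eps eta (fun y => 1 - quadratic_test n w eps H y)%R
     <= (C * M / (s * ((1 - s) * h - H)))%:E)%E.
Proof.
move=> w0 wC M0 eps0 /andP[s0 s1] Hh hw.
rewrite /obs_expectation mulrC.
have D0 : 0 < s * ((1 - s) * h - H) by rewrite mulr_gt0// subr_gt0.
have [mt t01] := quadratic_test_is_test n w eps H.
apply: (expectation_le_noise w0 wC M0) => [||omega|omega].
- by rewrite invr_ge0 ltW.
- apply: measurable_funB => //.
  exact/measurable_test_observation/quadratic_test_is_test.
- by have /andP[_] := t01 (observation xi eps eta omega); rewrite subr_ge0.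
have S0 : 0 <= \sum_(k < n) w k * (1 + xi k omega ^+ 2).
  by rewrite sumr_ge0// => k _; rewrite mulr_ge0// addr_ge0 ?sqr_ge0.
rewrite /quadratic_test indicE; case: (boolP (_ \in _)) => [_|].
  by rewrite subrr mulr_ge0// invr_ge0 ltW.
rewrite notin_setE /= subr0 => /negP; rewrite -leNgt => TH.
rewrite ler_pdivlMl// mulr1.
apply: (@le_trans _ _ (s * ((1 - s) * (\sum_(k < n) w k * (eta k / eps) ^+ 2)
    - quadratic_statistic n w eps (observation xi eps eta omega)))).
  rewrite ler_pM2l// lerB// ler_pM2l// subr_gt0//.
rewrite /quadratic_statistic mulr_sumr -sumrB mulr_sumr; apply: ler_sum => k _.
have -> : observation xi eps eta omega k / eps = eta k / eps + xi k omega.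
  by rewrite /observation; field; rewrite gt_eqF.
set th := eta k / eps; set x := xi k omega.
have -> : s * ((1 - s) * (w k * th ^+ 2) - w k * ((th + x) ^+ 2 - 1)) =
  w k * (s * ((1 - s) * th ^+ 2 - ((th + x) ^+ 2 - 1))) by ring.
rewrite ler_wpM2l//.
(* With the weight removed, the left side equals - (s th + x)^2 + (1 - s) x^2 + s, which is at most
   1 + x^2. *)
have := sqr_ge0 (s * th + x); nra.
Qed.

Lemma obs_expectation_ge0 eps eta psi : (forall y, 0 <= psi y) ->
  (0 <= obs_expectation xi eps eta psi)%E.
Proof. by move=> psi0; apply: expectation_ge0. Qed.

Lemma quadratic_test_total_error n (w : nat -> R) (T : set (nat -> R))
    (C eps H s h : R) :
  (forall k, 0 <= w k) -> \sum_(k < n) w k <= C -> 0 <= M ->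
  0 < eps -> 0 < s < 1 -> 0 < H < (1 - s) * h ->
  (forall eta, T eta -> h <= \sum_(k < n) w k * (eta k / eps) ^+ 2) ->
  (total_error xi eps T (quadratic_test n w eps H) <=
     (C * M / H + C * M / (s * ((1 - s) * h - H)))%:E)%E.
Proof.
move=> w0 wC M0 eps0 s01 /andP[H0 Hh] Th; rewrite /total_error EFinD leeD//.
  exact: quadratic_test_type1.
by apply: ge_ereal_sup => _ [eta Teta <-]; apply: quadratic_test_type2 => //; exact: Th.
Qed.

End chi_square_test.

(** * Nonnegative series and their partial sums *)

Section nonneg_series.
Context (R : realType) (u : nat -> R).

Lemma nneseries_leP (c : R) : (forall k, 0 <= u k) ->
  (\sum_(k <oo) (u k)%:E <= c%:E)%E <-> forall n, \sum_(k < n) u k <= c.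
Proof.
move=> u0; split=> [uc n|uc].
  rewrite -lee_fin; apply: le_trans uc; rewrite -sumEFin -(big_mkord xpredT (EFin \o u)).
  by apply: nneseries_lim_ge => k _ _; rewrite lee_fin.
apply: lime_le.
  by apply: is_cvg_nneseries => k _ _; rewrite lee_fin.
by apply: nearW => n; rewrite sumEFin lee_fin big_mkord.
Qed.

Lemma nneseries_finite (n : nat) : (forall k, 0 <= u k) ->
  (forall k, (n <= k)%N -> u k = 0) ->
  (\sum_(k <oo) (u k)%:E = (\sum_(k < n) u k)%:E)%E.
Proof.
move=> u0 un; rewrite (nneseries_split 0 n); last by move=> k _; rewrite lee_fin.
rewrite add0n eseries0 ?adde0; last by move=> k nk _; rewrite un.
by rewrite sumEFin big_mkord.
Qed.

End nonneg_series.

(** * Geometric growth of exponential sequences *)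

Section exponential_sequences.
Context (R : realType).

Lemma exp_seq_gt0 (c : R) k : 0 < exp_seq c k.
Proof. exact: expR_gt0. Qed.

Lemma exp_seqS (c : R) k : exp_seq c k.+1 = expR c * exp_seq c k.
Proof. by rewrite /exp_seq -expRD; congr expR; rewrite -[in LHS]natr1; ring. Qed.

Lemma exp_seq_ge1 (c : R) k : 0 < c -> 1 <= exp_seq c k.
Proof. by move=> c0; rewrite -expR0 ler_expR mulr_ge0// ltW. Qed.

Lemma exp_seq_le (c : R) j k : 0 < c -> (j <= k)%N -> exp_seq c j <= exp_seq c k.
Proof. by move=> c0 jk; rewrite ler_expR ler_pM2l// ler_nat. Qed.

Lemma exp_seq_unbounded (c t : R) : 0 < c -> 0 < t -> exists k, 1 <= t * exp_seq c k ^+ 2.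
Proof.
move=> c0 t0; have tc0 : 0 <= (t * c)^-1 by rewrite invr_ge0 mulr_ge0 ?ltW.
(* Since exp x >= x, it is enough that t c (k + 1) > 1; squaring a number that is at least 1 does
   not decrease it. *)
exists (Num.bound (t * c)^-1); set k := Num.bound _.
have kb : (t * c)^-1 < k.+1%:R.
  by apply: lt_trans (archi_boundP tc0) _; rewrite ltr_nat.
have tk : 1 < t * (c * k.+1%:R) by rewrite mulrA -ltr_pdivrMl ?mulr_gt0// mulr1.
rewrite (le_trans (ltW tk))// ler_pM2l//.
apply: (@le_trans _ _ (exp_seq c k)).
  by apply: le_trans (expR_ge1Dx _); rewrite lerDr.
by rewrite ler_eXnr// exp_seq_ge1.
Qed.

(** This locates the cut-off index of the extreme weights (t = A), of the truncated weights (t = r^2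
    / 2) and of the undetectable spike (t = r^2). *)
Lemma exp_seq_threshold (c t : R) : 0 < c -> 0 < t -> t * exp_seq c 0 ^+ 2 < 1 ->
  exists k, t * exp_seq c k ^+ 2 < 1 <= t * exp_seq c k.+1 ^+ 2.
Proof.
move=> c0 t0 t1; have ex := exp_seq_unbounded c0 t0.
case: (ex_minnP ex) => -[|k] kP kmin; first by move: t1; rewrite ltNge kP.
by exists k; rewrite kP andbT ltNge; apply/negP => /kmin; rewrite ltnn.
Qed.

(** A geometric sum is controlled by its last term. With p = exp(- c)^2, the induction step is the
    identity x / (1 - p) = p x / (1 - p) + x. *)
Lemma exp_seq_sum_sqr (c : R) n : 0 < c ->
  \sum_(k < n.+1) exp_seq c k ^+ 2 <= exp_seq c n ^+ 2 / (1 - expR (- c) ^+ 2).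
Proof.
move=> c0; have e1 : expR (- c) < 1 by rewrite expR_lt1 oppr_lt0.
have e0 := expR_gt0 (- c).
have D0 : 0 < 1 - expR (- c) ^+ 2 by rewrite subr_gt0 expr_lt1// ltW.
elim: n => [|n IH].
  rewrite big_ord1 ler_pdivlMr//; have := sqr_ge0 (exp_seq c 0); nra.
rewrite big_ord_recr/=.
have -> : exp_seq c n.+1 ^+ 2 / (1 - expR (- c) ^+ 2) =
  exp_seq c n ^+ 2 / (1 - expR (- c) ^+ 2) + exp_seq c n.+1 ^+ 2; last by rewrite lerD2r.
have -> : exp_seq c n = expR (- c) * exp_seq c n.+1.
  by rewrite exp_seqS mulrA -expRD addNr expR0 mul1r.
by field; rewrite gt_eqF.
Qed.

End exponential_sequences.

(** * Ellipsoid constraints and duality on the alternative *)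

Section ellipsoid.
Context (R : realType) (a sigma : nat -> R) (q : R).
Hypothesis hq : 0 < q <= 2.

Lemma powR_le_sqr (x : R) : 0 <= x <= 1 -> x ^+ 2 <= x `^ q.
Proof.
case/andP: hq => q0 q2 /andP[x0 x1]; rewrite -powR_mulrn//.
have [->|xn0] := eqVneq x 0; first by rewrite powR0 ?powR_ge0// pnatr_eq0.
by apply: ger_powR => //; rewrite lt_neqAle eq_sym xn0 x0.
Qed.

(** A term |a_k sigma_k eta_k| > 1 would exceed the total budget 1 by itself. So all terms lie in
    [0, 1], where x^2 <= x^q because q <= 2; hence Theta_q is contained in Theta_2. *)
Lemma Theta_sum_sqr_le1 eta n : Theta a sigma q eta ->
  \sum_(k < n) a k ^+ 2 * (sigma k ^+ 2 * eta k ^+ 2) <= 1.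
Proof.
move=> [_ /nneseries_leP]; move=> /(_ (fun k => powR_ge0 _ _)) h.
apply: le_trans (h n); apply: ler_sum => k _.
rewrite -!exprMn mulrA -[leLHS]real_normK ?num_real//.
apply: powR_le_sqr; rewrite normr_ge0 /= leNgt; apply/negP => x1.
have := h k.+1; rewrite big_ord_recr /= leNgt => /negP; apply.
rewrite ltr_wpDl ?sumr_ge0//.
have -> : 1 = 1 `^ q :> R by rewrite powR1.
apply: gt0_ltr_powR; rewrite ?nnegrE//.
by case/andP: hq.
Qed.

(* Lagrangian duality, with multipliers 1 and A for the two constraints. *)
Lemma alternative_duality (r A : R) (g : nat -> R) n eta :
  0 <= A -> (forall k, 0 <= g k) ->
  (forall k, sigma k ^+ 2 * (1 - A * a k ^+ 2) <= g k) ->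
  (forall k, (n <= k)%N -> g k = 0) ->
  Theta_alt a sigma q r eta ->
  r ^+ 2 - A <= \sum_(k < n) g k * eta k ^+ 2.
Proof.
move=> A0 g0 gge gn [Teta req].
rewrite lerBlDr -lee_fin; apply: le_trans req _.
apply/nneseries_leP => [k|N]; first by rewrite mulr_ge0 ?sqr_ge0.
have gN : \sum_(k < N) g k * eta k ^+ 2 <= \sum_(k < n) g k * eta k ^+ 2.
  have gu0 k : 0 <= g k * eta k ^+ 2 by rewrite mulr_ge0 ?sqr_ge0.
  apply: (proj1 (nneseries_leP _ gu0)).
  by rewrite (nneseries_finite (n := n))// => k nk; rewrite gn// mul0r.
apply: le_trans (lerD gN (ler_piMr A0 (Theta_sum_sqr_le1 N Teta))).
rewrite mulr_sumr -big_split/=; apply: ler_sum => k _.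
have := gge k; have := sqr_ge0 (eta k); nra.
Qed.

End ellipsoid.

(** * Mass and signal of the extreme weights *)

Section extreme_weights.
Context (R : realType) (alpha beta : R).
Hypotheses (alpha_gt0 : 0 < alpha) (beta_gt0 : 0 < beta).
Let a := exp_seq alpha.
Let sigma := exp_seq beta.

(** The three factors are the loss in passing from sigma_m to sigma_(m+1), the geometric sum of the
    sigma_k^2, and the lower bound on the cut-off factor 1 - A a_m^2. *)
Definition weight_bound : R :=
  expR beta ^+ 2 / (1 - expR (- beta) ^+ 2) / (1 - expR (- alpha) ^+ 2).

Lemma onem_expRN_sqr_gt0 (c : R) : 0 < c -> 0 < 1 - expR (- c) ^+ 2.
Proof.
by move=> c0; rewrite subr_gt0 expr_lt1// ?expR_ge0// expR_lt1 oppr_lt0.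
Qed.

(** The infimum lies between 0 and V, hence is finite, and [fine] returns its true value. *)
Lemma u_eps_le (eps r V : R) eta : 0 < eps -> 0 <= V ->
  Theta_alt a sigma 2 r eta -> (\sum_(k <oo) (eta k ^+ 4)%:E = V%:E)%E ->
  u_eps a sigma eps r <= Num.sqrt ((2 * eps ^+ 4)^-1 * V).
Proof.
move=> eps0 V0 Teta etaV; rewrite /u_eps ler_sqrt; last first.
  by rewrite mulr_ge0// invr_ge0 mulr_ge0// exprn_ge0// ltW.
rewrite ler_pM2l ?invr_gt0 ?mulr_gt0 ?exprn_gt0//.
set I := ereal_inf _.
have IV : (I <= V%:E)%E by apply: ereal_inf_lbound; exists eta.
have I0 : (0 <= I)%E.
  apply: le_ereal_inf_tmp => _ [x _ <-]; apply: nneseries_ge0 => k _ _.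
  by rewrite lee_fin exprn_even_ge0.
by rewrite -lee_fin fineK// ge0_fin_numE// (le_lt_trans IV) ?ltry.
Qed.

(** Let V be the sum of teta_k^4 and S = sqrt(2 V). Duality with multiplier A bounds the signal
    below by z0^2 (r^2 - A) / (S eps^2) = V / (S eps^2) = S / (2 eps^2). As [teta] lies in
    Theta_2(r), this value is at least [u_eps]. *)
Lemma extreme_sequence_weights (q r : R) teta :
  0 < q <= 2 -> r ^+ 2 * a 1 ^+ 2 < 1 -> extreme_sequence a sigma r teta ->
  exists n, [/\ forall k, 0 <= weights teta k,
    forall k, (n <= k)%N -> weights teta k = 0,
    \sum_(k < n) weights teta k <= weight_bound &
    forall eps eta, 0 < eps -> Theta_alt a sigma q r eta ->
      u_eps a sigma eps r <= \sum_(k < n) weights teta k * (eta k / eps) ^+ 2].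
Proof.
move=> hq ra1 [teta0 [z0 [A [tetaE sumr sum1]]]].
have a0 k : 0 < a k by exact: exp_seq_gt0.
have a_ge0 k : 0 <= a k by exact: ltW.
have s0 k : 0 < sigma k by exact: exp_seq_gt0.
have sr0 k : 0 <= sigma k ^+ 2 * teta k ^+ 2 by rewrite mulr_ge0 ?sqr_ge0.
have s10 k : 0 <= a k ^+ 2 * sigma k ^+ 2 * teta k ^+ 2.
  exact: mulr_ge0 (mulr_ge0 (sqr_ge0 _) (sqr_ge0 _)) (sqr_ge0 _).
have sum1_le n : \sum_(k < n) a k ^+ 2 * sigma k ^+ 2 * teta k ^+ 2 <= 1.
  by apply: (proj1 (nneseries_leP _ s10)); rewrite sum1.
have z_gt0 : 0 < z0 ^+ 2.
  rewrite lt_neqAle sqr_ge0 andbT; apply/eqP => z00; move: sum1.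
  rewrite eseries0 => [/eqP|k _ _]; first by rewrite eqe eq_sym oner_eq0.
  by rewrite tetaE -z00 !mul0r mulr0.
set z := z0 ^+ 2 in z_gt0 tetaE.
(* If A <= 0, no coordinate is cut off and the terms of the second constraint are at least z a_k^2,
   which eventually exceeds 1. *)
have A_gt0 : 0 < A.
  rewrite ltNge; apply/negP => A_le0.
  have [k kP] := exp_seq_unbounded alpha_gt0 (divr_gt0 z_gt0 (ltr0n R 2)).
  have := sum1_le k.+1; rewrite big_ord_recr /= leNgt => /negP; apply.
  rewrite ltr_wpDl ?sumr_ge0// tetaE max_r; last first.
    by rewrite subr_ge0 (@le_trans _ _ 0)// mulr_le0_ge0 ?sqr_ge0.
  have s1 : 1 <= sigma k ^+ 2 by rewrite exprn_ege1// exp_seq_ge1.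
  have A1 : 1 <= 1 - A * a k ^+ 2.
    by rewrite lerDl oppr_ge0 mulr_le0_ge0 ?sqr_ge0.
  have za : 1 < z * a k ^+ 2 by rewrite -/(a k) in kP; lra.
  have -> : a k ^+ 2 * sigma k ^+ 2 * (z * sigma k ^+ 2 * (1 - A * a k ^+ 2)) =
    z * a k ^+ 2 * (sigma k ^+ 2 * sigma k ^+ 2 * (1 - A * a k ^+ 2)) by ring.
  apply: (lt_le_trans za); rewrite ler_peMr ?(ltW (lt_trans ltr01 za))//.
  exact: mulr_ege1 (mulr_ege1 s1 s1) A1.
have tetaE2 k : A * a k ^+ 2 <= 1 ->
    teta k ^+ 2 = z * sigma k ^+ 2 * (1 - A * a k ^+ 2).
  by move=> Ak; rewrite tetaE max_r// subr_ge0.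
have teta_eq0 k : 1 <= A * a k ^+ 2 -> teta k ^+ 2 = 0.
  by move=> Ak; rewrite tetaE max_l ?mulr0// subr_le0.
have teta_supp n : 1 <= A * a n ^+ 2 -> forall k, (n <= k)%N -> teta k ^+ 2 = 0.
  move=> An k nk; apply: teta_eq0; apply: (le_trans An).
  by rewrite ler_pM2l// lerXn2r ?nnegrE ?a_ge0//; apply: exp_seq_le.
have teta40 k : 0 <= teta k ^+ 4 by rewrite exprn_even_ge0.
have teta4E k : teta k ^+ 4 = (teta k ^+ 2) ^+ 2 by rewrite -exprM.
(* Multiplying teta_k^2 = z sigma_k^2 (1 - A a_k^2) by teta_k^2 on the support and summing turns the
   two constraints into r^2 and A. *)
pose V := z * (r ^+ 2 - A).
have VE n : 1 <= A * a n ^+ 2 -> \sum_(k < n) teta k ^+ 4 = V.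
  move=> An; have tn := teta_supp n An.
  move: sumr sum1; rewrite (nneseries_finite (n := n))//; last first.
    by move=> k nk; rewrite tn// mulr0.
  move=> [sumr]; rewrite (nneseries_finite (n := n))//; last first.
    by move=> k nk; rewrite tn// mulr0.
  move=> [sum1']; rewrite /V -sumr -[A]mulr1 -[X in A * X]sum1'.
  rewrite mulr_sumr -sumrB mulr_sumr; apply: eq_bigr => k _.
  have [Ak|Ak] := leP (A * a k ^+ 2) 1.
    by rewrite teta4E expr2 {1}(tetaE2 k Ak); ring.
  by rewrite teta4E (teta_eq0 k (ltW Ak)) expr0n/= !mulr0 subrr mulr0.
have sumV : (\sum_(k <oo) (teta k ^+ 4)%:E = V%:E)%E.
  have [n An] := exp_seq_unbounded alpha_gt0 A_gt0.
  rewrite (nneseries_finite (n := n))// ?VE// => k nk.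
  by rewrite teta4E (teta_supp n An)// expr0n.
(* V = 0 would force [teta] to vanish, against the second constraint. Positivity then yields A <
   r^2. *)
have V_gt0 : 0 < V.
  have [n An] := exp_seq_unbounded alpha_gt0 A_gt0.
  rewrite lt_neqAle -{2}(VE n An) sumr_ge0// andbT; apply/eqP => V0.
  move: sum1; rewrite eseries0 => [/eqP|k _ _]; first by rewrite eqe eq_sym oner_eq0.
  have [nk|kn] := leqP n k; first by rewrite (teta_supp n An)// mulr0.
  have /eqP := VE n An; rewrite -V0 psumr_eq0// => /allP/(_ (Ordinal kn)).
  rewrite mem_index_enum => /(_ isT) /=; rewrite expf_eq0 /= => /eqP ->.
  by rewrite expr0n mulr0.
have Ar : A < r ^+ 2 by rewrite -subr_gt0 -(pmulr_rgt0 _ z_gt0).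
have Aa1 : A * a 1 ^+ 2 < 1.
  by apply: le_lt_trans ra1; rewrite ler_pM2r ?exprn_gt0// ltW.
have Aa0 : A * a 0 ^+ 2 < 1.
  apply: le_lt_trans Aa1; rewrite ler_pM2l// lerXn2r ?nnegrE ?a_ge0//.
  exact: exp_seq_le.
(* As A a_1^2 < 1, coordinate 1 is still active, so the last active index is some [m.+1] and has a
   predecessor m. *)
have [[|m] /andP[Am Am1]] := exp_seq_threshold alpha_gt0 A_gt0 Aa0.
  by move: Am1; rewrite leNgt Aa1.
pose S := Num.sqrt (2 * V).
have S_gt0 : 0 < S by rewrite sqrtr_gt0 mulr_gt0.
have wE k : weights teta k = teta k ^+ 2 / S by rewrite /weights sumV.
have w0 k : 0 <= weights teta k by rewrite wE divr_ge0 ?sqr_ge0// ltW.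
have wsupp k : (m.+2 <= k)%N -> weights teta k = 0.
  by move=> mk; rewrite wE (teta_supp _ Am1)// mul0r.
exists m.+2; split=> //.
  under eq_bigr do rewrite wE.
  rewrite -mulr_suml ler_pdivrMr//.
  (* The coordinate m, just before the last active one, keeps the cut-off
     factor 1 - A a_m^2 away from 0, and dominates the geometric sum. *)
  have tm : z * sigma m ^+ 2 * (1 - expR (- alpha) ^+ 2) <= S.
    apply: (@le_trans _ _ (teta m ^+ 2)).
      have am : A * a m ^+ 2 <= expR (- alpha) ^+ 2.
        have -> : a m = expR (- alpha) * a m.+1.
          by rewrite /a exp_seqS mulrA -expRD addNr expR0 mul1r.
        by rewrite exprMn mulrCA ler_piMr ?sqr_ge0// ltW.
      rewrite tetaE2; last first.
        by rewrite (le_trans am)// -subr_ge0 ltW// onem_expRN_sqr_gt0.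
      by rewrite ler_pM2l ?(mulr_gt0 z_gt0) ?exprn_gt0//; rewrite lerB.
    rewrite -[leLHS]ger0_norm ?sqr_ge0// -sqrtr_sqr ler_sqrt; last first.
      by rewrite mulr_ge0// ltW.
    rewrite -teta4E -(VE _ Am1) !big_ord_recr/= mulr_natl mulr2n.
    have := teta40 m; have := teta40 m.+1.
    have : 0 <= \sum_(i < m) teta i ^+ 4 by rewrite sumr_ge0.
    lra.
  have tsum : \sum_(k < m.+2) teta k ^+ 2 <=
      z * (sigma m.+1 ^+ 2 / (1 - expR (- beta) ^+ 2)).
    apply: (@le_trans _ _ (z * \sum_(k < m.+2) sigma k ^+ 2)); last first.
      by rewrite ler_pM2l//; exact: exp_seq_sum_sqr.
    rewrite mulr_sumr; apply: ler_sum => k _; rewrite tetaE -mulrA.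
    rewrite ler_pM2l// ler_piMr ?sqr_ge0// ge_max ler01 gerBl.
    by rewrite mulr_ge0 ?sqr_ge0// ltW.
  apply: (le_trans tsum).
  have Da := onem_expRN_sqr_gt0 alpha_gt0; have Db := onem_expRN_sqr_gt0 beta_gt0.
  apply: le_trans (ler_wpM2l _ tm); last first.
    by rewrite /weight_bound divr_ge0 ?ltW// divr_gt0// exprn_gt0// expR_gt0.
  rewrite le_eqVlt; apply/orP; left; apply/eqP.
  by rewrite /weight_bound {1}/sigma exp_seqS -/(sigma m); field; rewrite !gt_eqF.
move=> eps eta eps0 Teta.
pose g k := sigma k ^+ 2 * Num.max 0 (1 - A * a k ^+ 2).
have tg k : teta k ^+ 2 = z * g k by rewrite tetaE /g mulrA.
have dual : r ^+ 2 - A <= \sum_(k < m.+2) g k * eta k ^+ 2.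
  apply: (alternative_duality hq (ltW A_gt0) _ _ _ Teta) => [k|k|k mk].
  - by rewrite mulr_ge0 ?sqr_ge0// le_max lexx.
  - by rewrite ler_pM2l ?exprn_gt0// le_max lexx orbT.
  - have /eqP := tg k; rewrite (teta_supp _ Am1)// eq_sym mulf_eq0 gt_eqF//=.
    by move/eqP.
have S2 : S ^+ 2 = 2 * V by rewrite sqr_sqrtr// mulr_ge0// ltW.
apply: (@le_trans _ _ (S / (2 * eps ^+ 2))).
  have -> : S / (2 * eps ^+ 2) = Num.sqrt ((2 * eps ^+ 4)^-1 * V).
    rewrite -[LHS]ger0_norm; last by rewrite divr_ge0 ?ltW ?mulr_gt0 ?exprn_gt0.
    rewrite -sqrtr_sqr; congr Num.sqrt; rewrite expr_div_n S2; field.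
    by rewrite gt_eqF.
  (* Both constraints hold with equality for [teta], which makes it a competitor in the infimum
     defining [u_eps]. *)
  apply: u_eps_le sumV; rewrite ?ltW//; split; last first.
    by rewrite sumr.
  split.
    rewrite (nneseries_finite (n := m.+2)) ?ltry// => [k|k mk]; first exact: sqr_ge0.
    exact: (teta_supp _ Am1).
  rewrite -sum1 le_eqVlt; apply/orP; left; apply/eqP; apply: eq_eseriesr => k _.
  by rewrite powR_mulrn// real_normK ?num_real// !exprMn.
have -> : \sum_(k < m.+2) weights teta k * (eta k / eps) ^+ 2 =
    z / (S * eps ^+ 2) * \sum_(k < m.+2) g k * eta k ^+ 2.
  rewrite mulr_sumr; apply: eq_bigr => k _; rewrite wE tg; field.
  by rewrite !gt_eqF.
apply: le_trans (ler_wpM2l _ dual); last first.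
  by rewrite divr_ge0 ?(ltW z_gt0)// mulr_ge0 ?sqr_ge0// ltW.
have -> : z / (S * eps ^+ 2) * (r ^+ 2 - A) = V / (S * eps ^+ 2) by rewrite /V; ring.
have -> : V = S ^+ 2 / 2 by rewrite S2; field.
rewrite le_eqVlt; apply/orP; left; apply/eqP; field; by rewrite !gt_eqF.
Qed.

End extreme_weights.

(** * Where the rate exponent comes from *)

Section rate.
Context (R : realType) (alpha beta : R).
Hypotheses (alpha_gt0 : 0 < alpha) (beta_gt0 : 0 < beta).
Let a := exp_seq alpha.
Let sigma := exp_seq beta.
Let rate (eps : R) := eps `^ (alpha / (alpha + beta)).
Let kappa := 1 + beta / alpha.

(** [kappa] is the inverse of the exponent alpha / (alpha + beta), so (r / rate)^kappa = r^kappa /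
    eps. In logarithms the comparisons below become linear. *)
Lemma ln_div_rate (eps r : R) : 0 < eps -> 0 < r ->
  kappa * ln (r / rate eps) = kappa * ln r - ln eps.
Proof.
move=> eps0 r0; rewrite ln_div ?posrE ?powR_gt0// /rate ln_powR /kappa; field.
by rewrite !gt_eqF ?addr_gt0.
Qed.

(** Duality with multiplier r^2 / 2 keeps half of r^2, so the signal is at least r^2 / (2 sigma_m^2
    eps^2). The cut-off a_m^2 < 2 / r^2 bounds sigma_m^2 by (2 / r^2)^(beta / alpha). With rho = r /
    rate this gives 2^(- kappa) rho^(2 kappa), and rho >= 1 lowers the exponent to 1. *)
Lemma truncation_weights (q r : R) :
  0 < q <= 2 -> 0 < r -> r ^+ 2 / 2 * a 0 ^+ 2 < 1 ->
  exists n (w : nat -> R), [/\ forall k, 0 <= w k,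
    \sum_(k < n) w k <= (1 - expR (- beta) ^+ 2)^-1 &
    forall eps eta, 0 < eps -> 1 <= r / rate eps -> Theta_alt a sigma q r eta ->
      expR (- (kappa * ln 2)) * (r / rate eps) <=
        \sum_(k < n) w k * (eta k / eps) ^+ 2].
Proof.
move=> hq r0 ra0; have t0 : 0 < r ^+ 2 / 2 by rewrite divr_gt0// exprn_gt0.
have [m /andP[Am Am1]] := exp_seq_threshold alpha_gt0 t0 ra0.
have a_ge0 k : 0 <= a k by exact/ltW/exp_seq_gt0.
have s0 k : 0 < sigma k by exact: exp_seq_gt0.
pose g k := if (k < m.+1)%N then sigma k ^+ 2 else 0.
have g0 k : 0 <= g k by rewrite /g; case: ifP => _ //; rewrite sqr_ge0.
exists m.+1, (fun k => g k / sigma m ^+ 2); split.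
- by move=> k; rewrite divr_ge0// sqr_ge0.
- rewrite -mulr_suml ler_pdivrMr ?exprn_gt0// mulrC.
  apply: le_trans (exp_seq_sum_sqr m beta_gt0).
  by apply: ler_sum => k _; rewrite /g ltn_ord.
move=> eps eta eps0 rho1 Teta.
have dual : r ^+ 2 - r ^+ 2 / 2 <= \sum_(k < m.+1) g k * eta k ^+ 2.
  apply: (alternative_duality hq (ltW t0) g0 _ _ Teta) => k; last first.
    by rewrite /g leqNgt => /negbTE ->.
  rewrite /g; case: ltnP => mk.
    by rewrite ler_piMr ?sqr_ge0// gerBl mulr_ge0 ?sqr_ge0// ltW.
  rewrite mulr_ge0_le0 ?sqr_ge0// subr_le0 (le_trans Am1)// ler_pM2l//.
  by rewrite lerXn2r ?nnegrE ?a_ge0//; apply: exp_seq_le.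
have -> : \sum_(k < m.+1) g k / sigma m ^+ 2 * (eta k / eps) ^+ 2 =
    (sigma m ^+ 2 * eps ^+ 2)^-1 * \sum_(k < m.+1) g k * eta k ^+ 2.
  rewrite mulr_sumr; apply: eq_bigr => k _; field.
  by rewrite !gt_eqF.
apply: le_trans (ler_wpM2l _ dual); last by rewrite invr_ge0 mulr_ge0 ?sqr_ge0.
have rho0 : 0 < r / rate eps by rewrite divr_gt0// powR_gt0.
have -> : r ^+ 2 - r ^+ 2 / 2 = r ^+ 2 / 2 by field.
rewrite -ler_ln ?posrE; last 2 first.
- by rewrite mulr_gt0 ?expR_gt0.
- by rewrite mulr_gt0 ?invr_gt0 ?(mulr_gt0 (exprn_gt0 _ (s0 m))) ?exprn_gt0.
have se0 : 0 < sigma m ^+ 2 * eps ^+ 2 := mulr_gt0 (exprn_gt0 2 (s0 m)) (exprn_gt0 2 eps0).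
have -> : ln ((sigma m ^+ 2 * eps ^+ 2)^-1 * (r ^+ 2 / 2)) =
    ln r *+ 2 - ln 2 - ((beta * m.+1%:R) *+ 2 + ln eps *+ 2).
  rewrite mulrC !ln_div ?posrE ?divr_gt0 ?exprn_gt0//.
  by rewrite lnM ?posrE ?exprn_gt0// !lnXn// expRK.
rewrite lnM ?posrE ?expR_gt0// expRK.
have L0 : 0 <= ln (r / rate eps) by rewrite ln_ge0.
have h1 : ln r *+ 2 - ln 2 + (alpha * m.+1%:R) *+ 2 < 0.
  have : ln (r ^+ 2 / 2 * exp_seq alpha m ^+ 2) < 0.
    by rewrite ln_lt0// Am mulr_gt0// exprn_gt0// exp_seq_gt0.
  rewrite lnM ?posrE ?exprn_gt0 ?exp_seq_gt0// ln_div ?posrE ?exprn_gt0//.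
  by rewrite !lnXn ?exp_seq_gt0// expRK.
have := ln_div_rate eps0 r0.
set x := ln (r / rate eps) in L0 *; set N := m.+1%:R in h1 * => h2.
have h3 : 2 * (beta / alpha * ln r) - beta / alpha * ln 2 + 2 * (beta * N) < 0.
  have -> : 2 * (beta / alpha * ln r) - beta / alpha * ln 2 + 2 * (beta * N) =
    beta / alpha * (ln r *+ 2 - ln 2 + (alpha * N) *+ 2) by field; rewrite gt_eqF.
  by rewrite pmulr_rlt0// divr_gt0.
have kx : x <= kappa * x by rewrite ler_peMl// lerDl divr_ge0// ltW.
move: h3 kx; rewrite h2 /kappa !mulrDl !mul1r.
set u := beta / alpha * ln r; set v := beta / alpha * ln 2; set w := beta * N.
by move=> h3 kx; lra.
Qed.

(** The spike r / sigma_m has weighted energy exactly r^2 and is in Theta_q since r a_m <= 1.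
    Maximality of m gives r a_(m+1) >= 1, hence sigma_m >= exp(- beta) r^(- beta / alpha). So v /
    eps <= exp(beta) rho^kappa with rho = r / rate, and rho <= 1 gives the claim. *)
Lemma undetectable_signal (q r : R) :
  0 < q <= 2 -> 0 < r -> r ^+ 2 * a 0 ^+ 2 < 1 ->
  exists k v, [/\ 0 < v, Theta_alt a sigma q r (fun j => if j == k then v else 0) &
    forall eps, 0 < eps -> r / rate eps <= 1 ->
      v / eps <= expR beta * (r / rate eps)].
Proof.
move=> /andP[q0 q2] r0 ra0; have t0 : 0 < r ^+ 2 by rewrite exprn_gt0.
have [m /andP[Am Am1]] := exp_seq_threshold alpha_gt0 t0 ra0.
have a0 k : 0 < a k by exact: exp_seq_gt0.
have s0 k : 0 < sigma k by exact: exp_seq_gt0.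
have sumE (u : nat -> R) : (forall k, 0 <= u k) -> (forall k, k != m -> u k = 0) ->
    (\sum_(k <oo) (u k)%:E = (u m)%:E)%E.
  move=> u0 um; rewrite (nneseries_finite (n := m.+1))//; last first.
    by move=> k mk; rewrite um//; apply: contraTneq mk => ->; rewrite ltnn.
  by rewrite big_ord_recr/= big1 ?add0r// => i _; rewrite um// neq_ltn ltn_ord.
exists m, (r / sigma m); split; first by rewrite divr_gt0.
- split; first split.
  + rewrite sumE ?ltry// => [k|k /negbTE ->]; first by rewrite sqr_ge0.
    by rewrite expr0n.
  + rewrite sumE// => [|k /negbTE ->]; last by rewrite mulr0 normr0 powR0// gt_eqF.
    rewrite eqxx (_ : a m * sigma m * (r / sigma m) = r * a m); last first.
      by field; rewrite gt_eqF.
    have ra : 0 <= r * a m <= 1.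
      rewrite mulr_ge0 ?(ltW r0) ?(ltW (a0 m))//=.
      by rewrite -(@expr_le1 _ 2) ?mulr_ge0 ?(ltW r0) ?(ltW (a0 m))// exprMn ltW.
    have [ra_ge0 ra_le1] := andP ra; rewrite ger0_norm// lee_fin.
    have <- : 1 `^ q = 1 :> R by rewrite powR1.
    by rewrite ge0_ler_powR ?nnegrE// ltW.
  + rewrite sumE// => [|k|k /negbTE ->].
    * rewrite eqxx lee_fin le_eqVlt; apply/orP; left; apply/eqP.
      by field; rewrite gt_eqF.
    * by rewrite mulr_ge0 ?sqr_ge0.
    * by rewrite expr0n mulr0.
move=> eps eps0 rho1.
have rho0 : 0 < r / rate eps by rewrite divr_gt0// powR_gt0.
rewrite -ler_ln ?posrE ?mulr_gt0 ?expR_gt0 ?invr_gt0 ?powR_gt0//.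
have -> : ln (r / sigma m / eps) = ln r - beta * m.+1%:R - ln eps.
  by rewrite !ln_div ?posrE ?divr_gt0// expRK.
rewrite lnM ?posrE ?expR_gt0// expRK.
have L0 : ln (r / rate eps) <= 0 by rewrite ln_le0.
have h1 : 0 <= ln r *+ 2 + (alpha * m.+2%:R) *+ 2.
  have : 0 <= ln (r ^+ 2 * exp_seq alpha m.+1 ^+ 2) by rewrite ln_ge0.
  rewrite lnM ?posrE ?exprn_gt0 ?exp_seq_gt0// !lnXn ?exp_seq_gt0//.
  by rewrite expRK.
have := ln_div_rate eps0 r0.
rewrite -natr1 in h1.
set x := ln (r / rate eps) in L0 *; set N := m.+1%:R in h1 * => h2.
have h3 : 0 <= beta / alpha * ln r + beta * N + beta.
  have -> : beta / alpha * ln r + beta * N + beta =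
    beta / alpha / 2 * (ln r *+ 2 + (alpha * (N + 1)) *+ 2) by field; rewrite gt_eqF.
  by rewrite mulr_ge0// divr_ge0// divr_ge0// ltW.
have kx : kappa * x <= x by rewrite ler_neMl// lerDl divr_ge0// ltW.
move: h3 kx; rewrite h2 /kappa !mulrDl !mul1r.
set u := beta / alpha * ln r; set w := beta * N.
by move=> h3 kx; lra.
Qed.

End rate.

(** * Finite-dimensional rectangles in sequence space *)

Section cylinders.
Context (R : realType).

(** Rectangles, rather than general cylinder sets, suffice: they form a generating pi-system, and
    independence applies to them directly. *)
Definition cylinder : set (set (nat -> R)) :=
  [set A | exists n (B : nat -> set R), [/\ forall j, measurable (B j),
    forall j, (n <= j)%N -> B j = setT & A = [set y | forall j, B j (y j)]]].

Lemma cylinder_setI : setI_closed cylinder.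
Proof.
move=> _ _ [n [B [mB BT ->]]] [m [C [mC CT ->]]].
exists (maxn n m), (fun j => B j `&` C j); split.
- by move=> j; exact: measurableI.
- by move=> j; rewrite geq_max => /andP[nj mj]; rewrite BT// CT// setIT.
- by apply/seteqP; split=> [y [By Cy] j|y BC]; [split|split=> j; have [] := BC j].
Qed.

Lemma cylinder_setT : cylinder setT.
Proof. by exists 0%N, (fun=> setT); split=> //; apply/seteqP; split. Qed.

Lemma g_sigma_algebra_cylinder :
  (@measurable _ (g_sigma_algebraType (@coordinate_preimages R))) = <<s cylinder >>.
Proof.
apply/seteqP; split; apply: smallest_sub; try exact: smallest_sigma_algebra.
  move=> _ [k _ [B mB <-]]; apply: sub_sigma_algebra.
  exists k.+1, (fun j => if j == k then B else setT); split.
  - by move=> j; case: ifP.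
  - by move=> j kj; rewrite gtn_eqF.
  - rewrite setTI; apply/seteqP; split=> y /= => [By j|/(_ k)]; last by rewrite eqxx.
    by case: eqP => // ->.
move=> _ [n [B [mB _ ->]]].
rewrite (_ : [set y | _] = \bigcap_j ((fun y : nat -> R => y j) @^-1` B j)); last first.
  by apply/seteqP; split=> [y By j _|y By j]; apply: By.
apply: (@bigcapT_measurable _ (g_sigma_algebraType (@coordinate_preimages R))) => j.
by rewrite -[X in measurable X]setTI; apply: (@measurable_coordinate R j).
Qed.

End cylinders.

(** * Translation of a one-dimensional Gaussian integral *)

(** Half-open intervals keep their length under translation, and they determine Lebesgue measure. *)
Lemma lebesgue_measure_translation (R : realType) (c : R) (A : set R) : measurable A ->
  pushforward lebesgue_measure ((fun x => x + c) : _ -> measurableTypeR R) A =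
  lebesgue_measure A.
Proof.
move=> mA.
have mf : measurable_fun [set: measurableTypeR R]
    ((fun x => x + c) : measurableTypeR R -> measurableTypeR R).
  have : measurable_fun [set: R] (fun x : R => x + c) by exact: measurable_funD.
  by [].
apply/esym; apply: lebesgue_measure_unique => //= _ [[x y]] _ <-.
rewrite /pushforward /=.
rewrite (_ : _ @^-1` _ = `]x - c, y - c]%classic); last first.
  by apply/seteqP; split=> z /=; rewrite !in_itv/= ltrBlDr lerBrDr.
rewrite !lebesgue_measure_itv/= !lte_fin ltrD2r.
by case: ifP => // _; rewrite -!EFinB; congr EFin; ring.
Qed.

(* The ratio exp (m y - m^2 / 2) of the two densities is at least
   1 + m y - m^2 / 2. *)
Lemma normal_pdf_shift (R : realType) (m y : R) : 0 <= m <= 1 ->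
  normal_pdf 0 1 y <= normal_pdf 0 1 (y - m) + m * (1 + y ^+ 2) * normal_pdf 0 1 y.
Proof.
move=> /andP[m0 m1]; rewrite !normal_pdfE// /normal_fun !subr0 expr1n.
have -> : - (y - m) ^+ 2 / (1 *+ 2) = - y ^+ 2 / (1 *+ 2) + (m * y - m ^+ 2 / 2) :> R.
  by field.
rewrite expRD; set p := normal_peak 1; set e := expR (- y ^+ 2 / _).
have pe : 0 <= p * e by rewrite mulr_ge0 ?normal_peak_ge0 ?expR_ge0.
have := expR_ge1Dx (m * y - m ^+ 2 / 2); set E := expR _ => hE.
have -> : p * (e * E) + m * (1 + y ^+ 2) * (p * e) = p * e * (E + m * (1 + y ^+ 2)).
  by ring.
rewrite ler_peMr//.
(* The quadratic is (y + 1/2)^2 + 3/4 - m / 2, positive for m <= 1. This is what remains after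
   inserting the lower bound on E. *)
have : 0 <= m * (y ^+ 2 + y + 1 - m / 2).
  by rewrite mulr_ge0//; have := sqr_ge0 (y + 2^-1); nra.
by nra.
Qed.

(** Translation moves the shift from F to the density, where [normal_pdf_shift] applies pointwise.
    Since F <= 1, the remainder integrates to at most m M. *)
Lemma normal_integral_shift (R : realType) (M m : R) (F : R -> R) :
  (\int[@lebesgue_measure R]_x ((1 + x ^+ 2)%:E * (normal_pdf 0 1 x)%:E) <= M%:E)%E ->
  0 <= m <= 1 -> measurable_fun [set: R] F -> (forall x, 0 <= F x <= 1) ->
  (\int[@lebesgue_measure R]_x ((F x)%:E * (normal_pdf 0 1 x)%:E) <=
   \int[@lebesgue_measure R]_x ((F (x + m))%:E * (normal_pdf 0 1 x)%:E) + (m * M)%:E)%E.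
Proof.
move=> hM m01 mF F01; have [m0 _] := andP m01.
have F0 x : 0 <= F x by case/andP: (F01 x).
have mpdf (c : R) : measurable_fun [set: R] (fun x => normal_pdf 0 1 (x - c)).
  by apply: measurableT_comp; [exact: measurable_normal_pdf|exact: measurable_funB].
have mp : measurable_fun [set: R] (normal_pdf (0 : R) 1) by exact: measurable_normal_pdf.
have p0 (x : R) : 0 <= normal_pdf 0 1 x by exact: normal_pdf_ge0.
have mtr : measurable_fun [set: measurableTypeR R]
    ((fun x => x + m) : measurableTypeR R -> measurableTypeR R).
  have : measurable_fun [set: R] (fun x : R => x + m) by exact: measurable_funD.
  by [].
have mG : measurable_fun [set: R] (fun y => (F y)%:E * (normal_pdf 0 1 (y - m))%:E)%E.
  by apply: emeasurable_funM; exact/measurable_EFinP.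
have -> : (\int[@lebesgue_measure R]_x ((F (x + m))%:E * (normal_pdf 0 1 x)%:E) =
    \int[@lebesgue_measure R]_y ((F y)%:E * (normal_pdf 0 1 (y - m))%:E))%E.
  transitivity (\int[@lebesgue_measure R]_x
      ((fun y => (F y)%:E * (normal_pdf 0 1 (y - m))%:E) \o (fun x => (x + m)%R)) x)%E.
    by apply: eq_integral => x _ /=; rewrite addrK.
  rewrite -[LHS](ge0_integral_pushforward mtr lebesgue_measure measurableT mG).
    by apply: eq_measure_integral => A mA _; exact: lebesgue_measure_translation.
  by move=> y _; rewrite mule_ge0// lee_fin.
have mM : measurable_fun [set: R] (fun x => (1 + x ^+ 2)%:E * (normal_pdf 0 1 x)%:E)%E.
  apply: emeasurable_funM; apply/measurable_EFinP => //.
  by apply: measurable_funD => //; exact: measurable_funX.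
have M0 (x : R) : (0 <= (1 + x ^+ 2)%:E * (normal_pdf 0 1 x)%:E)%E.
  by rewrite mule_ge0 ?lee_fin// addr_ge0 ?sqr_ge0.
apply: (@le_trans _ _ (\int[@lebesgue_measure R]_x
    ((F x)%:E * (normal_pdf 0 1 (x - m))%:E +
      m%:E * ((1 + x ^+ 2)%:E * (normal_pdf 0 1 x)%:E)))%E).
  apply: ge0_le_integral => //.
  - by move=> x _; rewrite mule_ge0// lee_fin.
  - by apply: emeasurable_funM; exact/measurable_EFinP.
  - by apply: emeasurable_funD => //; exact: emeasurable_funM.
  move=> x _; rewrite -!EFinM -EFinD lee_fin.
  have /andP[f0 f1] := F01 x.
  have := ler_wpM2l f0 (normal_pdf_shift x m01).
  rewrite mulrDr => /le_trans; apply; rewrite lerD2l mulrA.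
  by rewrite ler_piMl// !mulr_ge0 ?addr_ge0 ?sqr_ge0.
rewrite ge0_integralD//; last 3 first.
- by move=> x _; rewrite mule_ge0// lee_fin.
- by move=> x _; rewrite mule_ge0// lee_fin.
- exact: emeasurable_funM.
rewrite leeD2l// ge0_integralZl// ?lee_fin// EFinM.
by rewrite lee_wpmul2l// lee_fin.
Qed.

(** * Effect of a spike in a single coordinate *)

Section replace_coordinate.
Context (R : realType) (d : measure_display) (Omega : measurableType d)
  (P : probability Omega R) (xi : nat -> {RV P >-> R}).
Hypothesis hxi : iid_std_normal xi.
Let Q := g_sigma_algebraType (@coordinate_preimages R).
Let N01 : probability (measurableTypeR R) R := normal_prob 0 1.

Definition single_spike (k : nat) (v : R) (j : nat) : R := if j == k then v else 0.

(* Under [normal_prob 0 1 \x P] this has the law of the observation, with its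
   k-th coordinate made explicit. *)
Definition resampled_observation (eps : R) (k : nat) (v : R)
    (p : measurableTypeR R * Omega) : Q :=
  fun j => if j == k then v + eps * p.1 else eps * xi j p.2.

Lemma measurable_resampled_observation eps k v :
  measurable_fun [set: measurableTypeR R * Omega] (resampled_observation eps k v).
Proof.
apply: measurable_coordinatewise => j; rewrite /resampled_observation.
case: (j == k).
  by apply: measurable_funD => //; exact: measurable_funM.
apply: measurable_funM => //.
exact: measurableT_comp (measurable_funPT (xi j)) measurable_snd.
Qed.

(** On a rectangle both sides are the same product: independence separates coordinate k from the
    others on the left, and the product measure does so on the right. *)
Lemma law_observation_resampled eps k v (A : set Q) : measurable A ->
  P (observation xi eps (single_spike k v) @^-1` A) =
  (N01 \x P)%E (resampled_observation eps k v @^-1` A).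
Proof.
move=> mA.
have mo := measurable_observation xi eps (single_spike k v).
have mr := measurable_resampled_observation eps k v.
rewrite -[LHS]/(pushforward P (observation xi eps (single_spike k v) : Omega -> Q) A).
rewrite -[RHS]/(pushforward (N01 \x P)%E (resampled_observation eps k v) A).
apply: (@measure_unique _ R Q (@cylinder R) (fun=> setT)) => //.
- exact: g_sigma_algebra_cylinder.
- exact: cylinder_setI.
- by move=> _; exact: cylinder_setT.
- by rewrite bigcup_const.
- move=> _ [n [B [mB BT ->]]].
  pose C j := [set x : R | B j (single_spike k v j + eps * x)].
  have mC j : measurable (C j).
    rewrite -[C j]setTI.
    apply: (_ : measurable_fun setT (fun x => single_spike k v j + eps * x)) => //.
    by apply: measurable_funD => //; exact: measurable_funM.
  (* The bound [k.+1] puts k itself into [J], so that it can be split off even when its constraint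
     is trivial. *)
  pose J := [fset j in iota 0 (maxn n k.+1)]%fset.
  have kJ : k \in J by rewrite !inE mem_iota /= add0n leq_max ltnSn orbT.
  have notJ j : j \notin J -> B j = setT.
    by rewrite !inE mem_iota /= add0n -leqNgt geq_max => /andP[nj _]; exact: BT.
  have indep (K : {fset nat}) :
      P (\bigcap_(j in [set` K]) (xi j @^-1` C j)) =
      (\prod_(j <- K) P (xi j @^-1` C j))%E by apply: hxi.1.
  transitivity (P (\bigcap_(j in [set` J]) (xi j @^-1` C j))).
    congr (P _); apply/seteqP; split=> omega /= h j; first by move=> _; exact: h.
    by have [/h//|/notJ ->] := boolP (j \in J).
  transitivity ((N01 \x P)%E
      (C k `*` \bigcap_(j in [set` (J `\ k)%fset]) (xi j @^-1` C j))); last first.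
    apply/esym; rewrite /= /pushforward; congr ((N01 \x P)%E _).
    apply/seteqP; split=> p /=.
      move=> h; split=> [|j /=].
        by have := h k; rewrite /C /= /resampled_observation /single_spike eqxx.
      rewrite !inE => /andP[/negbTE jk _]; have := h j.
      by rewrite /C /= /resampled_observation /single_spike jk add0r.
    move=> [hk h] j; rewrite /resampled_observation /=.
    have [->|jk] := eqVneq j k.
      by move: hk; rewrite /C /= /single_spike eqxx.
    have [jJ|/notJ -> //] := boolP (j \in J).
    have := h j; rewrite /C /= /single_spike (negbTE jk) add0r; apply.
    by rewrite /= in_fsetD1 jk.
  have mcap : measurable (\bigcap_(j in [set` (J `\ k)%fset]) (xi j @^-1` C j)).
    apply: bigcap_measurableType => j _.
    by rewrite -[X in measurable X]setTI; exact: (measurable_funPT (xi j)).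
  rewrite indep (big_fsetD1 k)//= -indep.
  rewrite (product_measure1E N01 P (mC k) mcap); congr (_ * _)%E.
  exact: hxi.2.
- by move=> _; rewrite /= /pushforward preimage_setT probability_setT ltry.
Qed.

Lemma obs_expectation_resampled eps k v (f : (nat -> R) -> R) :
  measurable_fun [set: Q] f -> (forall y, 0 <= f y) ->
  obs_expectation xi eps (single_spike k v) f =
  (\int[P]_omega \int[@lebesgue_measure R]_x
     ((f (resampled_observation eps k v (x, omega)))%:E * (normal_pdf 0 1 x)%:E))%E.
Proof.
move=> mf f0; rewrite /obs_expectation unlock.
have mo := measurable_observation xi eps (single_spike k v).
have mr := measurable_resampled_observation eps k v.
have mfE : measurable_fun [set: Q] (EFin \o f) by exact/measurable_EFinP.
have f0E : {in [set: Q], forall y, (0 <= (EFin \o f) y)%E}.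
  by move=> y _; rewrite lee_fin.
transitivity (\int[(N01 \x P)%E]_p (f (resampled_observation eps k v p))%:E)%E.
  rewrite -[LHS](ge0_integral_pushforward mo P measurableT mfE f0E).
  rewrite -[RHS](ge0_integral_pushforward mr (N01 \x P)%E measurableT mfE f0E).
  by apply: eq_measure_integral => A mA _; exact: law_observation_resampled.
rewrite fubini_tonelli2//; last 2 first.
- by apply/measurable_EFinP; exact: (measurableT_comp mf mr).
- by move=> p; rewrite lee_fin.
apply: eq_integral => omega _; rewrite /fubini_G.
apply: ge0_integral_density => //.
- exact: measurable_normal_pdf.
- by move=> x; exact: normal_pdf_ge0.
- apply/measurable_EFinP; apply: (measurableT_comp (measurableT_comp mf mr)).
  exact: measurable_pair2.
- by move=> x; rewrite lee_fin.
Qed.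

(** With the other coordinates fixed, adding v to coordinate k translates its standard normal noise
    by v / eps. The one-dimensional bound is then averaged over the others. *)
Lemma obs_expectation_spike M eps (k : nat) v (f : (nat -> R) -> R) :
  (\int[@lebesgue_measure R]_x ((1 + x ^+ 2)%:E * (normal_pdf 0 1 x)%:E) <= M%:E)%E ->
  0 <= M -> 0 < eps -> 0 <= v / eps <= 1 ->
  measurable_fun [set: Q] f -> (forall y, 0 <= f y <= 1) ->
  (obs_expectation xi eps (fun=> 0%R) f <=
     obs_expectation xi eps (single_spike k v) f + (v / eps * M)%:E)%E.
Proof.
move=> hM M0 eps0 veps mf f01; have [ve0 _] := andP veps.
have f0 y : 0 <= f y by case/andP: (f01 y).
have -> : (fun=> 0) = single_spike k 0 :> (nat -> R).
  by apply/funext => j; rewrite /single_spike; case: ifP.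
rewrite !obs_expectation_resampled//.
pose h u (p : measurableTypeR R * Omega) : \bar R :=
  ((f (resampled_observation eps k u p))%:E * (normal_pdf 0 1 p.1)%:E)%E.
have mpdf : measurable_fun [set: measurableTypeR R] (normal_pdf (0 : R) 1).
  exact: measurable_normal_pdf.
have mh u : measurable_fun [set: measurableTypeR R * Omega] (h u).
  apply: emeasurable_funM; apply/measurable_EFinP.
    exact: (measurableT_comp mf (measurable_resampled_observation _ _ _)).
  exact: (measurableT_comp mpdf measurable_fst).
have h0 u p : (0 <= h u p)%E by rewrite mule_ge0// lee_fin ?normal_pdf_ge0.
have mG u : measurable_fun [set: Omega]
    (fun omega => \int[@lebesgue_measure R]_x h u (x, omega))%E.
  exact: (measurable_fun_fubini_tonelli_G (m1 := @lebesgue_measure R) (h u) (mh u) (h0 u)).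
have G0 u omega : (0 <= \int[@lebesgue_measure R]_x h u (x, omega))%E.
  by apply: integral_ge0 => x _.
have veM : (0 <= (v / eps * M)%:E)%E by rewrite lee_fin mulr_ge0.
apply: (@le_trans _ _ (\int[P]_omega
    ((\int[@lebesgue_measure R]_x h v (x, omega)) + (v / eps * M)%:E))%E).
  apply: ge0_le_integral => //.
  - by move=> omega _; exact: (G0 0 omega).
  - exact: (mG 0).
  - by apply: emeasurable_funD; [exact: mG|exact: measurable_cst].
  move=> omega _.
  pose F (x : R) := f (resampled_observation eps k 0 (x, omega)).
  have mF : measurable_fun [set: measurableTypeR R] F.
    apply: (measurableT_comp (measurableT_comp mf (measurable_resampled_observation _ _ _))).
    exact: measurable_pair2.
  have := normal_integral_shift hM veps mF (fun x => f01 _).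
  move=> /le_trans; apply; rewrite leeD2r// le_eqVlt; apply/orP; left; apply/eqP.
  apply: eq_integral => x _; rewrite /h /F; congr ((f _)%:E * _)%E.
  apply/funext => j; rewrite /resampled_observation /=; case: ifP => // _.
  by field; rewrite gt_eqF.
rewrite ge0_integralD//.
by rewrite integral_cst//= probability_setT mule1.
Qed.

End replace_coordinate.

(** * Trivial bounds on errors and minimax errors *)

Section errors.
Context (R : realType) (d : measure_display) (Omega : measurableType d)
  (P : probability Omega R) (xi : nat -> {RV P >-> R}).

Lemma obs_expectation_cst eps eta (c : R) : obs_expectation xi eps eta (fun=> c) = c%:E.
Proof. exact: expectation_cst. Qed.

Lemma is_test_cst (c : R) : 0 <= c <= 1 -> is_test (fun=> c).
Proof. by move=> c01; split=> //; exact: measurable_cst. Qed.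

Lemma type1_error_ge0 eps psi : is_test psi -> (0 <= type1_error xi eps psi)%E.
Proof. by move=> [_ t01]; apply: obs_expectation_ge0 => y; case/andP: (t01 y). Qed.

(** Non-emptiness of T matters: the supremum of the empty set is -oo. *)
Lemma type2_error_ge0 eps (T : set (nat -> R)) psi : T !=set0 -> is_test psi ->
  (0 <= type2_error xi eps T psi)%E.
Proof.
move=> [eta Teta] [_ t01]; apply: le_trans (ereal_sup_ubound _); last first.
  by exists eta => //; reflexivity.
by apply: obs_expectation_ge0 => y; rewrite subr_ge0; case/andP: (t01 y).
Qed.

Lemma type2_error_cst_le eps (T : set (nat -> R)) (c : R) :
  (type2_error xi eps T (fun=> c) <= (1 - c)%:E)%E.
Proof. by apply: ge_ereal_sup => _ [eta _ <-]; rewrite obs_expectation_cst. Qed.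

Lemma total_error_ge0 eps (T : set (nat -> R)) psi : T !=set0 -> is_test psi ->
  (0 <= total_error xi eps T psi)%E.
Proof. by move=> T0 tpsi; rewrite adde_ge0 ?type1_error_ge0 ?type2_error_ge0. Qed.

Lemma type2_le_total_error eps (T : set (nat -> R)) psi : is_test psi ->
  (type2_error xi eps T psi <= total_error xi eps T psi)%E.
Proof. by move=> tpsi; rewrite leeDr// type1_error_ge0. Qed.

Lemma type1_le_total_error eps (T : set (nat -> R)) psi : T !=set0 -> is_test psi ->
  (type1_error xi eps psi <= total_error xi eps T psi)%E.
Proof. by move=> T0 tpsi; rewrite leeDl// type2_error_ge0. Qed.

Lemma minimax_total_error_ge0 eps (T : set (nat -> R)) : T !=set0 ->
  (0 <= minimax_total_error xi eps T)%E.
Proof.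
by move=> T0; apply: le_ereal_inf_tmp => _ [psi tpsi <-]; exact: total_error_ge0.
Qed.

Lemma minimax_type2_error_ge0 eps (T : set (nat -> R)) theta : T !=set0 ->
  (0 <= minimax_type2_error xi eps T theta)%E.
Proof.
by move=> T0; apply: le_ereal_inf_tmp => _ [psi [tpsi _] <-]; exact: type2_error_ge0.
Qed.

Lemma minimax_total_error_le eps (T : set (nat -> R)) psi : is_test psi ->
  (minimax_total_error xi eps T <= total_error xi eps T psi)%E.
Proof. by move=> tpsi; apply: ereal_inf_lbound; exists psi. Qed.

Lemma minimax_type2_error_le eps (T : set (nat -> R)) theta psi : is_test psi ->
  (type1_error xi eps psi <= theta%:E)%E ->
  (minimax_type2_error xi eps T theta <= type2_error xi eps T psi)%E.
Proof. by move=> tpsi ptheta; apply: ereal_inf_lbound; exists psi. Qed.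

(** The test that never rejects has type I error 0 and type II error at most 1. *)
Lemma minimax_total_error_le1 eps (T : set (nat -> R)) :
  (minimax_total_error xi eps T <= 1%:E)%E.
Proof.
apply: (le_trans (minimax_total_error_le _ _ (is_test_cst (c := 0) _))).
  by rewrite lexx ler01.
rewrite /total_error /type1_error obs_expectation_cst add0e.
by apply: le_trans (type2_error_cst_le _ _ _) _; rewrite subr0.
Qed.

(** Rejecting with constant probability theta, whatever the data, is admissible at level theta. *)
Lemma minimax_type2_error_le_onem eps (T : set (nat -> R)) (theta : R) : 0 < theta < 1 ->
  (minimax_type2_error xi eps T theta <= (1 - theta)%:E)%E.
Proof.
move=> /andP[t0 t1]; apply: le_trans (type2_error_cst_le _ _ _).
apply: minimax_type2_error_le; first by apply: is_test_cst; rewrite !ltW.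
by rewrite /type1_error obs_expectation_cst.
Qed.

Lemma obs_expectation_onem eps eta psi : is_test psi ->
  (obs_expectation xi eps eta psi + obs_expectation xi eps eta (fun y => 1 - psi y)%R
   = 1%:E)%E.
Proof.
move=> tpsi; have [_ t01] := tpsi.
have mpsi := measurable_test_observation xi eps eta tpsi.
rewrite /obs_expectation unlock -ge0_integralD//.
- transitivity (\int[P]_omega (1%:E : \bar R))%E.
    by apply: eq_integral => omega _; rewrite -EFinD addrC subrK.
  by rewrite integral_cst//= probability_setT mule1.
- by move=> omega _; rewrite lee_fin; case/andP: (t01 (observation xi eps eta omega)).
- exact/measurable_EFinP.
- move=> omega _; rewrite lee_fin subr_ge0.
  by case/andP: (t01 (observation xi eps eta omega)).
- by apply/measurable_EFinP; exact: measurable_funB.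
Qed.

End errors.

Lemma statistic_quadratic (R : realType) (eta : nat -> R) n :
  (forall k, (n <= k)%N -> weights eta k = 0) ->
  statistic eta = quadratic_statistic n (weights eta).
Proof.
move=> wn; apply/funext => eps; apply/funext => y; rewrite /statistic.
apply: lim_near_cst => //; exists n => // N /= nN.
rewrite /series /= (@big_cat_nat _ _ _ n)//= [X in _ + X]big_nat_cond.
rewrite [X in _ + X]big1 ?addr0 ?big_mkord// => k /andP[/andP[nk _] _].
by rewrite wn// mul0r.
Qed.

(** * Error bounds at a fixed noise level *)

Section fixed_noise_level.
Context (R : realType) (d : measure_display) (Omega : measurableType d)
  (P : probability Omega R) (xi : nat -> {RV P >-> R}).
Hypothesis hxi : iid_std_normal xi.
Context (M q alpha beta : R).
Hypothesis hM :
  (\int[@lebesgue_measure R]_x ((1 + x ^+ 2)%:E * (normal_pdf 0 1 x)%:E) <= M%:E)%E.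
Hypotheses (M_gt0 : 0 < M) (hq : 0 < q <= 2) (alpha_gt0 : 0 < alpha) (beta_gt0 : 0 < beta).
Let a := exp_seq alpha.
Let sigma := exp_seq beta.
Let rate (eps : R) := eps `^ (alpha / (alpha + beta)).

Lemma noise_second_moment k : (\int[P]_omega (1 + xi k omega ^+ 2)%:E <= M%:E)%E.
Proof.
rewrite (std_normal_integral hxi k (f := fun x => (1 + x ^+ 2)%:E))//.
- by apply/measurable_EFinP/measurable_funD => //; exact: measurable_funX.
- by move=> x; rewrite lee_fin addr_ge0 ?sqr_ge0.
Qed.

Lemma Theta_alt_neq0 r : 0 < r -> r ^+ 2 * a 0 ^+ 2 < 1 -> Theta_alt a sigma q r !=set0.
Proof.
move=> r0 ra; have [k [v [_ Tv _]]] := undetectable_signal alpha_gt0 beta_gt0 hq r0 ra.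
by eexists; exact: Tv.
Qed.

(** The signal is at least u = [u_eps], while H stays a fixed fraction of u away from both 0 and u,
    so both Markov bounds are of order 1 / u. *)
Lemma extreme_test_error_le c eps r H teta :
  0 < c < 1 -> 0 < eps -> r ^+ 2 * a 1 ^+ 2 < 1 -> extreme_sequence a sigma r teta ->
  0 < u_eps a sigma eps r ->
  c / 2 * u_eps a sigma eps r <= H <= (1 + c) / 2 * u_eps a sigma eps r ->
  is_test (threshold_test teta eps H) /\
  (total_error xi eps (Theta_alt a sigma q r) (threshold_test teta eps H) <=
    (weight_bound alpha beta * M * (2 / c + 16 / (1 - c) ^+ 2) /
       u_eps a sigma eps r)%:E)%E.
Proof.
move=> /andP[c0 c1] eps0 ra ext; set u := u_eps _ _ _ _ => u0 /andP[Hu1 Hu2].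
have [n [w0 wn wC wu]] := extreme_sequence_weights alpha_gt0 beta_gt0 hq ra ext.
have -> : threshold_test teta eps H = quadratic_test n (weights teta) eps H.
  by rewrite /threshold_test (statistic_quadratic wn).
split; first exact: quadratic_test_is_test.
have C0 : 0 <= weight_bound alpha beta by apply: le_trans wC; rewrite sumr_ge0.
have H0 : 0 < H by apply: lt_le_trans Hu1; rewrite mulr_gt0// divr_gt0.
(* This s solves (1 - s) - (1 + c) / 2 = s, so the type II denominator is at least s^2 u; this
   produces 16 / (1 - c)^2. *)
pose s := (1 - c) / 4.
have s01 : 0 < s < 1 by rewrite /s; apply/andP; split; lra.
have [s0 _] := andP s01.
have su : s * u <= (1 - s) * u - H.
  rewrite lerBrDl (le_trans (lerD Hu2 (lexx _)))// -mulrDl ler_wpM2r ?(ltW u0)// /s; lra.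
have su0 : 0 < s * u by rewrite mulr_gt0.
apply: le_trans (quadratic_test_total_error noise_second_moment w0 wC (ltW M_gt0)
  eps0 s01 (h := u) _ (fun eta => wu eps eta eps0)) _.
  by rewrite H0 /= -subr_gt0 (lt_le_trans su0).
have CM0 : 0 <= weight_bound alpha beta * M by rewrite mulr_ge0// ltW.
have -> : weight_bound alpha beta * M * (2 / c + 16 / (1 - c) ^+ 2) / u =
    weight_bound alpha beta * M * (2 / c / u) +
    weight_bound alpha beta * M * (16 / (1 - c) ^+ 2 / u) by ring.
rewrite lee_fin lerD// ler_wpM2l//.
  have -> : 2 / c / u = (c / 2 * u)^-1 by field; rewrite !gt_eqF.
  by rewrite lef_pV2 ?posrE// mulr_gt0// divr_gt0.
have -> : 16 / (1 - c) ^+ 2 / u = (s * (s * u))^-1.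
  by rewrite /s; field; rewrite !gt_eqF ?subr_gt0.
have D0 : 0 < (1 - s) * u - H := lt_le_trans su0 su.
rewrite lef_pV2 ?posrE; [by rewrite ler_pM2l|by rewrite mulr_gt0|by rewrite mulr_gt0].
Qed.

(** With H = h / 3 and s = 1 / 3 the two Markov bounds have denominators h / 3 and h / 9, whence 12
    = 3 + 9; the exponential is the constant in the signal bound h. *)
Definition detection_constant : R :=
  12 * ((1 - expR (- beta) ^+ 2)^-1 * M) / expR (- ((1 + beta / alpha) * ln 2)).

Lemma exists_detecting_test eps r :
  0 < eps -> 0 < r -> r ^+ 2 / 2 * a 0 ^+ 2 < 1 -> 1 <= r / rate eps ->
  exists2 psi, is_test psi &
    (total_error xi eps (Theta_alt a sigma q r) psi <=
       (detection_constant / (r / rate eps))%:E)%E.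
Proof.
move=> eps0 r0 ra rho1.
have [n [w [w0 wC wh]]] := truncation_weights alpha_gt0 beta_gt0 hq r0 ra.
pose h := expR (- ((1 + beta / alpha) * ln 2)) * (r / rate eps).
have h0 : 0 < h by rewrite mulr_gt0 ?expR_gt0// (lt_le_trans ltr01).
exists (quadratic_test n w eps (h / 3)); first exact: quadratic_test_is_test.
apply: le_trans (quadratic_test_total_error noise_second_moment w0 wC (ltW M_gt0)
  eps0 (s := 1 / 3) _ (h := h) _ (fun eta => wh eps eta eps0 rho1)) _.
- by apply/andP; split; lra.
- by apply/andP; split; lra.
rewrite lee_fin le_eqVlt; apply/orP; left; apply/eqP.
have -> : detection_constant / (r / rate eps) =
    12 * ((1 - expR (- beta) ^+ 2)^-1 * M) / h.
  by rewrite /detection_constant /h [in RHS]invfM [RHS]mulrA.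
set CM := _^-1 * M; field.
by rewrite gt_eqF.
Qed.

Definition indistinguishability_constant : R := expR beta * M.

(** At eta = 0 the rejection and acceptance probabilities add up to 1. Replacing the acceptance
    probability by its value at the spike costs at most M v / eps. *)
Lemma error_sum_ge eps r psi :
  0 < eps -> 0 < r -> r ^+ 2 * a 0 ^+ 2 < 1 -> r / rate eps <= 1 ->
  expR beta * (r / rate eps) <= 1 -> is_test psi ->
  (1%:E <= type1_error xi eps psi + type2_error xi eps (Theta_alt a sigma q r) psi +
     (indistinguishability_constant * (r / rate eps))%:E)%E.
Proof.
move=> eps0 r0 ra rho1 brho1 tpsi; have [mpsi t01] := tpsi.
have [k [v [v0 Tv vle]]] := undetectable_signal alpha_gt0 beta_gt0 hq r0 ra.
have ve := vle _ eps0 rho1.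
have ve01 : 0 <= v / eps <= 1 by rewrite (divr_ge0 (ltW v0) (ltW eps0)) (le_trans ve).
rewrite -(obs_expectation_onem xi eps (fun=> 0) tpsi) -addeA leeD2l//.
apply: le_trans (obs_expectation_spike hxi k hM (ltW M_gt0) eps0 ve01 _ _) _.
- by apply: measurable_funB => //; exact: measurable_cst.
- by move=> y; have /andP[p0 p1] := t01 y; rewrite subr_ge0 p1 gerBl p0.
apply: leeD.
  by apply: ereal_sup_ubound; exists (single_spike k v).
by rewrite lee_fin /indistinguishability_constant [leRHS]mulrAC ler_wpM2r// ltW.
Qed.

Lemma minimax_total_error_ge eps r :
  0 < eps -> 0 < r -> r ^+ 2 * a 0 ^+ 2 < 1 -> r / rate eps <= 1 ->
  expR beta * (r / rate eps) <= 1 ->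
  ((1 - indistinguishability_constant * (r / rate eps))%:E <=
     minimax_total_error xi eps (Theta_alt a sigma q r))%E.
Proof.
move=> eps0 r0 ra rho1 brho1; apply: le_ereal_inf_tmp => _ [psi tpsi <-].
by rewrite EFinB leeBlDr//; exact: error_sum_ge.
Qed.

Lemma minimax_type2_error_ge eps r theta :
  0 < eps -> 0 < r -> r ^+ 2 * a 0 ^+ 2 < 1 -> r / rate eps <= 1 ->
  expR beta * (r / rate eps) <= 1 ->
  ((1 - theta - indistinguishability_constant * (r / rate eps))%:E <=
     minimax_type2_error xi eps (Theta_alt a sigma q r) theta)%E.
Proof.
move=> eps0 r0 ra rho1 brho1; apply: le_ereal_inf_tmp => _ [psi [tpsi ptheta] <-].
rewrite EFinB leeBlDr// EFinB leeBlDl//.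
apply: le_trans (error_sum_ge eps0 r0 ra rho1 brho1 tpsi) _.
by rewrite addeA leeD2r// leeD2r.
Qed.

End fixed_noise_level.

(** * Passage to the limit as the noise level tends to 0 *)

Section limits.
Context (R : realType) (I : Type) (F : set_system I) {FF : Filter F}.

Lemma squeeze_EFin (f : I -> \bar R) (g h : I -> R) (l : R) :
  (\forall x \near F, (g x)%:E <= f x <= (h x)%:E)%E ->
  g x @[x --> F] --> l -> h x @[x --> F] --> l -> f x @[x --> F] --> l%:E.
Proof.
move=> gfh gl hl; apply: (squeeze_cvge gfh).
  by apply: cvg_EFin => //; apply: nearW.
by apply: cvg_EFin => //; apply: nearW.
Qed.

Lemma cvg_mul_0 (u : I -> R) (K : R) :
  u x @[x --> F] --> 0 -> K * u x @[x --> F] --> 0.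
Proof. by move=> u0; rewrite -[0](mulr0 K); exact: cvgMl_tmp. Qed.

Lemma cvg_div_pinfty (u : I -> R) (K : R) :
  u x @[x --> F] --> +oo -> K / u x @[x --> F] --> 0.
Proof.
move=> uy; have u0 : \forall x \near F, 0 < u x by exact: (proj1 (cvgryPgt u) uy 0).
by apply: cvg_mul_0; exact: (proj2 (gtr0_cvgV0 u0) uy).
Qed.

End limits.

Lemma near_sqr_mul_lt1 (R : realType) (r : R -> R) (c : R) : 0 < c ->
  r eps @[eps --> 0^'+] --> (0 : R) ->
  \forall eps \near 0^'+, r eps ^+ 2 * c < 1.
Proof.
move=> c0 r_to0.
have : r eps ^+ 2 * c @[eps --> 0^'+] --> (0 ^+ 2 * c : R).
  apply: cvgMr_tmp; rewrite expr2; under eq_fun do rewrite expr2; exact: cvgM.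
by rewrite expr0n mul0r => h; apply: (cvgr_lt (0 : R)) => //.
Qed.

Theorem theorem4p3 (R : realType) (d : measure_display)
    (Omega : measurableType d) (P : probability Omega R)
    (xi : nat -> {RV P >-> R}) (hxi : iid_std_normal xi)
    (q alpha beta : R) (hq : 0 < q <= 2) (halpha : 0 < alpha)
    (hbeta : 0 < beta) :
  let a := exp_seq alpha in
  let sigma := exp_seq beta in
  (forall (r : R -> R) (teta : R -> nat -> R) (c : R) (H : R -> R),
     (forall eps, 0 < eps -> 0 < r eps) ->
     r eps @[eps --> 0^'+] --> (0 : R) ->
     (\forall eps \near 0^'+, extreme_sequence a sigma (r eps) (teta eps)) ->
     u_eps a sigma eps (r eps) @[eps --> 0^'+] --> +oo ->
     0 < c < 1 ->
     H eps / (c * u_eps a sigma eps (r eps)) @[eps --> 0^'+] --> (1 : R) ->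
     total_error xi eps (Theta_alt a sigma q (r eps))
         (threshold_test (teta eps) eps (H eps))
       @[eps --> 0^'+] --> 0%:E) /\
  separation_rate xi (Theta_alt a sigma q)
    (fun eps => eps `^ (alpha / (alpha + beta))).
Proof.
move=> a sigma; have [M M0 hM] := normal_second_moment R.
have sqr_a0 k : 0 < a k ^+ 2 by rewrite exprn_gt0// exp_seq_gt0.
split.
  move=> r teta c H r0 r_to0 ext u_toy c01 Hcu; have [c0 c1] := andP c01.
  apply: (@squeeze_EFin _ _ _ _ _ (fun=> 0) (fun eps =>
    weight_bound alpha beta * M * (2 / c + 16 / (1 - c) ^+ 2) /
       u_eps a sigma eps (r eps))); [|exact: cvg_cst|exact: cvg_div_pinfty].
  (* The limit 1 lies strictly between 1/2 and (1 + c) / (2 c), the latter because c < 1. Multiplied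
     by c u, these bounds are the window for H required by [extreme_test_error_le]. *)
  have Hcu1 : \forall eps \near 0^'+, 2^-1 < H eps / (c * u_eps a sigma eps (r eps)).
    by apply: (cvgr_gt (1 : R)) => //; lra.
  have Hcu2 : \forall eps \near 0^'+,
      H eps / (c * u_eps a sigma eps (r eps)) < (1 + c) / 2 / c.
    by apply: (cvgr_lt (1 : R)) => //; rewrite ltr_pdivlMr//; lra.
  have u0 := proj1 (cvgryPgt _) u_toy 0.
  have ra0 := near_sqr_mul_lt1 (sqr_a0 0) r_to0.
  have ra1 := near_sqr_mul_lt1 (sqr_a0 1) r_to0.
  near=> eps.
  have eps0 : 0 < eps by near: eps; exact: nbhs_right_gt.
  have u_gt0 : 0 < u_eps a sigma eps (r eps) by near: eps; exact: u0.
  have [] := @extreme_test_error_le _ _ _ _ _ hxi M q alpha beta hM M0 hq halpha hbeta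
    c eps (r eps) (H eps) (teta eps) c01 eps0.
  - by near: eps; exact: ra1.
  - by near: eps; exact: ext.
  - by [].
  - apply/andP; split.
      have : 2^-1 < H eps / (c * u_eps a sigma eps (r eps)) by near: eps; exact: Hcu1.
      rewrite ltr_pdivlMr ?mulr_gt0// => /ltW; apply: le_trans.
      by rewrite mulrA (mulrC _ c).
    have : H eps / (c * u_eps a sigma eps (r eps)) < (1 + c) / 2 / c by near: eps; exact: Hcu2.
    rewrite ltr_pdivrMr ?mulr_gt0// => /ltW/le_trans; apply.
    by rewrite mulrA divfK ?gt_eqF.
  move=> tpsi ->; rewrite andbT; apply: total_error_ge0 => //.
  apply: (Theta_alt_neq0 hq halpha hbeta); first exact: r0.
  by near: eps; exact: ra0.
split.
- by move=> eps eps0; exact: powR_gt0.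
- by apply: powR_cvg0; rewrite divr_gt0// addr_gt0.
move=> r r0 r_to0; have ra0 := near_sqr_mul_lt1 (sqr_a0 0) r_to0.
split=> [rho0|rhoy].
  pose K := indistinguishability_constant M beta.
  have Krho : K * (r eps / eps `^ (alpha / (alpha + beta))) @[eps --> 0^'+] --> (0 : R).
    exact: cvg_mul_0.
  have brho : \forall eps \near 0^'+,
      expR beta * (r eps / eps `^ (alpha / (alpha + beta))) < 1.
    apply: (cvgr_lt (0 : R)) => //.
    exact: cvg_mul_0.
  have rho1 : \forall eps \near 0^'+, r eps / eps `^ (alpha / (alpha + beta)) < 1.
    exact: (cvgr_lt (0 : R)).
  have lim (x : R) :
      x - K * (r eps / eps `^ (alpha / (alpha + beta))) @[eps --> 0^'+] --> x.
    by rewrite -[X in _ --> X]subr0; apply: cvgB => //; exact: cvg_cst.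
  split=> [|theta theta01].
    apply: (squeeze_EFin (h := fun=> 1) _ (lim 1)); last exact: cvg_cst.
    near=> eps; rewrite minimax_total_error_le1 andbT.
    have eps0 : 0 < eps by near: eps; exact: nbhs_right_gt.
    apply: (minimax_total_error_ge hxi hM M0 hq halpha hbeta eps0 (r0 _ eps0)).
    - by near: eps; exact: ra0.
    - by apply: ltW; near: eps; exact: rho1.
    - by apply: ltW; near: eps; exact: brho.
  apply: (squeeze_EFin (h := fun=> 1 - theta) _ (lim (1 - theta))); last exact: cvg_cst.
  near=> eps; rewrite minimax_type2_error_le_onem// andbT.
  have eps0 : 0 < eps by near: eps; exact: nbhs_right_gt.
  apply: (minimax_type2_error_ge hxi hM M0 hq halpha hbeta _ eps0 (r0 _ eps0)).
  - by near: eps; exact: ra0.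
  - by apply: ltW; near: eps; exact: rho1.
  - by apply: ltW; near: eps; exact: brho.
pose K := detection_constant M alpha beta.
have Krho : K / (r eps / eps `^ (alpha / (alpha + beta))) @[eps --> 0^'+] --> (0 : R).
  exact: cvg_div_pinfty.
have rho1 := proj1 (cvgryPge _) rhoy 1.
have a02 : 0 < 2^-1 * a 0 ^+ 2 by rewrite mulr_gt0.
have ra02 := near_sqr_mul_lt1 a02 r_to0.
split=> [|theta /andP[theta0 theta1]].
  apply: (squeeze_EFin (g := fun=> 0) _ _ Krho); last exact: cvg_cst.
  near=> eps.
  have eps0 : 0 < eps by near: eps; exact: nbhs_right_gt.
  have T0 : Theta_alt a sigma q (r eps) !=set0.
    by apply: (Theta_alt_neq0 hq halpha hbeta); [exact: r0|near: eps; exact: ra0].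
  rewrite minimax_total_error_ge0//=.
  have [||psi tpsi psile] := exists_detecting_test hxi hM M0 hq halpha hbeta eps0 (r0 _ eps0).
  - by rewrite -mulrA; near: eps; exact: ra02.
  - by near: eps; exact: rho1.
  by apply: le_trans psile; exact: minimax_total_error_le.
(* Once its total error is below theta, the detecting test is itself admissible at level theta and
   bounds the minimax type II error too. *)
have Ktheta : \forall eps \near 0^'+,
    K / (r eps / eps `^ (alpha / (alpha + beta))) < theta.
  exact: (cvgr_lt (0 : R)).
apply: (squeeze_EFin (g := fun=> 0) _ _ Krho); last exact: cvg_cst.
near=> eps.
have eps0 : 0 < eps by near: eps; exact: nbhs_right_gt.
have T0 : Theta_alt a sigma q (r eps) !=set0.
  by apply: (Theta_alt_neq0 hq halpha hbeta); [exact: r0|near: eps; exact: ra0].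
rewrite minimax_type2_error_ge0//=.
have [||psi tpsi psile] := exists_detecting_test hxi hM M0 hq halpha hbeta eps0 (r0 _ eps0).
- by rewrite -mulrA; near: eps; exact: ra02.
- by near: eps; exact: rho1.
apply: le_trans (le_trans (type2_le_total_error xi eps _ tpsi) psile).
apply: minimax_type2_error_le => //.
apply: (le_trans (type1_le_total_error _ _ T0 tpsi)); apply: (le_trans psile).
by rewrite lee_fin ltW//; near: eps; exact: Ktheta.
Unshelve. all: by end_near.
Qed.
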